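(* Let $p\geq 5$ be a prime with $p\neq 11$. (i) If $b_{21}\left(\frac{11p^2-5}{6}\right)\equiv 1\pmod 2$, then for all integers $n,k\geq 0$ and all integers $\beta$ with $1\leq\beta<p$, \[ b_{21}\left(4p^{4k+4}n+4p^{4k+3}\beta+\frac{11p^{4k+4}-5}{6}\right)\equiv 0\pmod 2, \] and for all $k\geq 0$, $b_{21}\left(\frac{11p^{4k}-5}{6}\right)\equiv 1\pmod 2$. (ii) If $b_{21}\left(\frac{11p^2-5}{6}\right)\equiv 0\pmod 2$, then for all integers $n,k\geq 0$ with $p\nmid (24n+11)$, \[ b_{21}\left(4p^{6k+2}n+\frac{11p^{6k+2}-5}{6}\right)\equiv 0\pmod 2, \] and for all $k\geq 0$, $b_{21}\left(\frac{11p^{6k}-5}{6}\right)\equiv 1\pmod 2$.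
   Context: $b_{21}(n)$ denotes the number of $21$-regular partitions of $n$, i.e. partitions of $n$ none of whose parts is divisible by $21$ (with $b_{21}(0)=1$); equivalently $\sum_{n\geq 0}b_{21}(n)q^n=\prod_{k\geq1}\frac{1-q^{21k}}{1-q^k}$. *)

(* Defs.v *)
From mathcomp Require Import all_boot.

Set Implicit Arguments.
Unset Strict Implicit.
Unset Printing Implicit Defensive.

Definition is_partition (n : nat) (s : seq nat) : bool :=
  [&& sorted geq s, 0 \notin s & sumn s == n].

Definition is_regular_partition (l n : nat) (s : seq nat) : bool :=
  is_partition n s && all (fun k => ~~ (l %| k)) s.

(* A partition of n has at most n parts, each at most n, so counting over the
   finite type of sequences of length at most n with entries in 'I_n.+1 misses
   none; see num_regular_partitionsP. *)
Definition num_regular_partitions (l n : nat) : nat :=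
  #|[set s : n.-bseq 'I_n.+1 |
      is_regular_partition l n [seq val i | i <- s]]|.

Notation b21 := (num_regular_partitions 21).

Lemma num_regular_partitionsP (l n : nat) (ps : seq (seq nat)) :
  uniq ps -> (forall s, (s \in ps) = is_regular_partition l n s) ->
  num_regular_partitions l n = size ps.
Proof.
move=> ups psP; rewrite /num_regular_partitions cardE.
set e := enum _; pose f (s : n.-bseq 'I_n.+1) := [seq val i | i <- s].
rewrite -(size_map f); apply: perm_size; apply: uniq_perm => //.
  rewrite map_inj_uniq ?enum_uniq // => s t /(inj_map val_inj) st.
  exact: val_inj.
move=> s; rewrite psP; apply/mapP/idP => [[t]|sP].
  by rewrite mem_enum inE => + ->.
have /andP[/and3P[_ s0 /eqP sumE] _] := sP.
have szs : size s <= n.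
  rewrite -sumE; elim: s s0 {sP sumE} => //= a s IHs.
  rewrite inE negb_or eq_sym -lt0n => /andP[a0 /IHs].
  by rewrite -add1n; apply: leq_add.
have les : all (fun k => k < n.+1) s.
  rewrite -sumE; elim: s {s0 sP sumE szs} => //= a s IHs.
  rewrite ltnS leq_addr /=; apply: sub_all IHs => k /=.
  by rewrite !ltnS => /leq_trans -> //; rewrite leq_addl.
have szt : size [seq inord k : 'I_n.+1 | k <- s] <= n by rewrite size_map.
have tE : [seq val i | i <- [seq inord k : 'I_n.+1 | k <- s]] = s.
  rewrite -map_comp -[RHS]map_id; apply/eq_in_map => k ks /=.
  by rewrite inordK //; apply: (allP les).
by exists (Bseq szt); rewrite /f ?mem_enum ?inE /= tE.
Qed.

Lemma num_regular_partitions0 (l : nat) : num_regular_partitions l 0 = 1.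
Proof.
rewrite (@num_regular_partitionsP l 0 [:: [::]]) // => -[|a s] //.
rewrite inE /is_regular_partition /is_partition inE negb_or /= addn_eq0.
by case: a => [|a]; rewrite /= ?andbF.
Qed.

(* Main.v *)
(* Write f_a = \prod_(k >= 1) (1 - q^(a k)) modulo 2, so that f_(2 a) = f_a ^ 2.
   The generating function of b_21 is f_21 / f_1 = f_21 f_1^3 / f_4.  By the
   Jacobi triple product, f_21 and f_1^3 are theta series, and counting the
   solutions of 7 x^2 + y^2 = 16 (2 n + 1) in Q(sqrt (-7)) shows that the terms
   of exponent 4 n + 1 of f_21 f_1^3 form f_12 (in q^n).  Hence
   \sum_n b_21(4 n + 1) q^n = f_12 / f_1 = f_3 * (f_3^3 / f_1), again a product of
   two theta series: b_21(4 n + 1) has the parity of the number a(N), for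
   N = 24 n + 11, of integers (k, z) with 8 k^2 + 3 z^2 = N and k = z = -1 mod 3.

   If p is inert in Q(sqrt (-6)), every solution for p^2 N is divisible by p.
   If p splits, p^2 = u^2 + 24 v^2, and multiplication by u +- v sqrt (-24) yields
   the solutions for p^2 N not divisible by p, but shifts the class of z modulo
   3 by v.  The solutions with 3 | z being even in number, a satisfies modulo 2
     a(p^2 N) = ([p does not divide N] + lam) a(N) + a(N / p^2),
   where lam = 1 when p splits and 3 does not divide v.  As a(11) = 1, the case
   N = 11 identifies lam with 1 + b_21((11 p^2 - 5) / 6), and the sequence
   a(p^(2 j) m) has period 2 in j if lam = 0 and period 3 if lam = 1. *)

Require Import Defs.
From Stdlib Require Import Classical.
From mathcomp Require Import all_boot all_order all_algebra.
From mathcomp Require Import zify ring.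

Set Implicit Arguments.
Unset Strict Implicit.
Unset Printing Implicit Defensive.

Import GRing.Theory Num.Theory.

(** * Gaussian binomials and the finite triple product *)

Section QBinomial.

Local Open Scope ring_scope.

Variable R : comNzRingType.
Implicit Types (q x : R).

(** The Gaussian binomial coefficient, by a q-Pascal rule that avoids division. Where [n' - j']
    truncates, the coefficient it multiplies is 0. *)
Fixpoint qbinom q (n j : nat) : R :=
  match n, j with
  | _, 0%N => 1
  | 0%N, _.+1 => 0
  | n'.+1, j'.+1 => qbinom q n' j + q ^+ (n' - j') * qbinom q n' j'
  end.

Arguments qbinom : simpl never.

Lemma qbinom0 q n : qbinom q n 0 = 1.
Proof. by case: n. Qed.

Lemma qbinomS q n j :
  qbinom q n.+1 j.+1 = qbinom q n j.+1 + q ^+ (n - j) * qbinom q n j.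
Proof. by []. Qed.

Lemma qbinom_small q n j : (n < j)%N -> qbinom q n j = 0.
Proof.
elim: n j => [|n IHn] [|j] // nj.
by rewrite qbinomS !IHn ?mulr0 ?addr0 //; apply: ltnW.
Qed.

(** The mirror Pascal rule: the defining rule adds a factor on the [b] side of the triple product,
    this one on the [c] side. *)
Lemma qbinomS' q n j :
  qbinom q n.+1 j.+1 = q ^+ j.+1 * qbinom q n j.+1 + qbinom q n j.
Proof.
elim: n j => [|n IHn] j.
  by rewrite qbinomS /= (_ : qbinom q 0 j.+1 = 0) // mulr0 !add0r sub0n mul1r.
rewrite (qbinomS q n.+1) {1}IHn (qbinomS q n j).
case: j => [|j]; first by rewrite !qbinom0 !subn0 (exprS q n) expr1; ring.
rewrite {1}(IHn j) (qbinomS q n j); case: (ltnP j n) => [jn|nj]; last first.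
  rewrite !(@qbinom_small q n _.+1) ?ltnS ?(leqW nj) //.
  by rewrite subSS (eqP nj) expr0; ring.
rewrite subSS; have -> : (n - j = (n - j.+1).+1)%N by lia.
by rewrite !exprS; ring.
Qed.

Lemma qbinom_fact q n j : (j <= n)%N ->
  qbinom q n j * \prod_(k < j) (1 - q ^+ k.+1) = \prod_(i < j) (1 - q ^+ (n - i)).
Proof.
elim: n j => [|n IHn] [|j] //; rewrite ?big_ord0 ?qbinom0 ?mulr1 //.
rewrite ltnS => jn.
have E : q ^+ (n - j) * qbinom q n j * \prod_(k < j.+1) (1 - q ^+ k.+1)
    = q ^+ (n - j) * \prod_(i < j) (1 - q ^+ (n - i)) * (1 - q ^+ j.+1).
  by rewrite -IHn // big_ord_recr /=; ring.
rewrite qbinomS mulrDl E [in RHS]big_ord_recl subn0.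
under [in RHS]eq_bigr => i _ do rewrite lift0 subSS.
case: (ltnP j n) => jn'.
  rewrite IHn // big_ord_recr /=.
  have -> : q ^+ n.+1 = q ^+ (n - j) * q ^+ j.+1.
    by rewrite -exprD; congr (_ ^+ _); lia.
  ring.
have -> : j = n by lia.
by rewrite qbinom_small // subnn expr0; ring.
Qed.

(* The exponent of the [n]-th term, [n = j - M] an integer, of the theta series
   [\sum_n x ^ ((b + c) * n (n - 1) / 2 + b * n]; one of the two truncated
   differences vanishes. *)
Local Open Scope nat_scope.

Definition theta_exp (b c M j : nat) : nat :=
  ((b + c) * 'C(j - M, 2) + b * (j - M)
   + ((b + c) * 'C(M - j, 2) + c * (M - j)))%N.

(** Multiplying the [j]-th theta term by the monomial of the factor 1 + x^((b + c) N + b) moves it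
    to [j.+1], up to the power of q in the Pascal rule. *)
Lemma theta_expS b c M N j : (j <= M + N)%N ->
  ((b + c) * (M + N - j) + theta_exp b c M j.+1
   = (b + c) * N + b + theta_exp b c M j)%N.
Proof.
move=> jMN; rewrite /theta_exp; case: (leqP M j) => Mj.
  have [k jE] : exists k, j = M + k by exists (j - M); lia.
  have [l ->] : exists l, N = k + l by exists (N - k); lia.
  rewrite {}jE.
  have -> : M + (k + l) - (M + k) = l by lia.
  have [-> ->] : (M + k).+1 - M = k.+1 /\ M + k - M = k by lia.
  have [-> ->] : M - (M + k).+1 = 0 /\ M - (M + k) = 0 by lia.
  by rewrite binS bin1; nia.
have [k ->] : exists k, M = j + k.+1 by exists (M - j.+1); lia.
have -> : j + k.+1 + N - j = k.+1 + N by lia.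
have [-> ->] : j.+1 - (j + k.+1) = 0 /\ j - (j + k.+1) = 0 by lia.
have [-> ->] : j + k.+1 - j.+1 = k /\ j + k.+1 - j = k.+1 by lia.
by rewrite binS bin1; nia.
Qed.

Lemma theta_expSl b c M j :
  ((b + c) * j + theta_exp b c M.+1 j = (b + c) * M + c + theta_exp b c M j)%N.
Proof.
rewrite /theta_exp; case: (leqP j M) => Mj.
  have [k ->] : exists k, M = j + k by exists (M - j); lia.
  have -> : (j + k).+1 - j = k.+1 by lia.
  have -> : j - (j + k).+1 = 0 by lia.
  have [-> ->] : j - (j + k) = 0 /\ j + k - j = k by lia.
  by rewrite binS bin1; nia.
have [k ->] : exists k, j = M + k.+1 by exists (j - M.+1); lia.
have [-> ->] : M + k.+1 - M.+1 = k /\ M + k.+1 - M = k.+1 by lia.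
have [-> ->] : M.+1 - (M + k.+1) = 0 /\ M - (M + k.+1) = 0 by lia.
by rewrite binS bin1; nia.
Qed.

Local Open Scope ring_scope.

(** Induction on [N] for [M = 0], then on [M]. For each new factor 1 + y, the Pascal rule splits the
    sum into the old sum and y times the old sum. *)
Lemma finite_jacobi x b c M N :
  \sum_(j < (M + N).+1) qbinom (x ^+ (b + c)) (M + N) j * x ^+ theta_exp b c M j
  = (\prod_(i < N) (1 + x ^+ ((b + c) * i + b)))
    * \prod_(i < M) (1 + x ^+ ((b + c) * i + c)).
Proof.
set q := x ^+ (b + c).
elim: M => [|M IHM].
  rewrite [X in _ = _ * X]big_ord0 mulr1; elim: N => [|N IHN].
    by rewrite big_ord1 big_ord0 qbinom0 mul1r /theta_exp !muln0.
  rewrite [in RHS]big_ord_recr /= -IHN !add0n mulrDr mulr1.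
  rewrite big_ord_recl qbinom0.
  under eq_bigr => j _ do rewrite lift0 qbinomS mulrDl.
  rewrite big_split addrA; congr (_ + _).
    rewrite [in RHS]big_ord_recl qbinom0 big_ord_recr /= qbinom_small //.
    by rewrite mul0r addr0; congr (_ + _); apply: eq_bigr => j _; rewrite lift0.
  rewrite mulr_suml; apply: eq_bigr => j _.
  rewrite mulrAC -exprM -exprD -mulrA -exprD mulrC; congr (_ * x ^+ _).
  have := @theta_expS b c 0 N j; rewrite !add0n => -> //; first exact: addnC.
  by rewrite -ltnS.
rewrite [in RHS]big_ord_recr /= mulrA -IHM mulrDr mulr1 addSn.
rewrite big_ord_recl qbinom0.
under eq_bigr => j _ do rewrite lift0 qbinomS' mulrDl.
rewrite big_split addrA [LHS]addrC; congr (_ + _); rewrite mulr_suml.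
transitivity (\sum_(j < (M + N).+2)
   q ^+ j * qbinom q (M + N) j * x ^+ theta_exp b c M.+1 j).
  by rewrite [RHS]big_ord_recl qbinom0 expr0 !mul1r.
rewrite big_ord_recr /= qbinom_small // mulr0 mul0r addr0.
apply: eq_bigr => j _; rewrite mulrAC -exprM -exprD -mulrA -exprD mulrC.
by rewrite theta_expSl; congr (_ * x ^+ _); exact: addnC.
Qed.

End QBinomial.

(** * Polynomials over F_2 modulo a power of the variable *)

Section TruncatedSeries.

Local Open Scope ring_scope.

Implicit Types p q r : {poly 'F_2}.

Definition eqX (m : nat) p q := 'X^m %| p - q.

Lemma eqXP m p q : reflect (forall i, (i < m)%N -> p`_i = q`_i) (eqX m p q).
Proof.
apply: (iffP idP) => [/dvdpP[r pqE] i im|pqE].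
  apply/eqP; rewrite -subr_eq0 -coefB pqE coefMXn im //.
rewrite /eqX; suff -> : p - q = drop_poly m (p - q) * 'X^m by apply: dvdp_mull.
rewrite -[LHS](poly_take_drop m) [take_poly _ _](_ : _ = 0) ?add0r //.
apply/polyP => i; rewrite coef_take_poly coef0 coefB; case: ltnP => // im.
by rewrite pqE // subrr.
Qed.

Lemma eqX_refl m p : eqX m p p. Proof. by apply/eqXP. Qed.

Lemma eqX_sym m p q : eqX m p q -> eqX m q p.
Proof. by move=> /eqXP pq; apply/eqXP => i im; rewrite pq. Qed.

Lemma eqX_trans m q p r : eqX m p q -> eqX m q r -> eqX m p r.
Proof. by move=> /eqXP pq /eqXP qr; apply/eqXP => i im; rewrite pq // qr. Qed.

Lemma eqX_mul m p p' q q' : eqX m p p' -> eqX m q q' -> eqX m (p * q) (p' * q').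
Proof.
move=> pp' qq'; rewrite /eqX.
have -> : p * q - p' * q' = (p - p') * q + p' * (q - q') by ring.
by apply: dvdp_add; [apply: dvdp_mulr | apply: dvdp_mull].
Qed.

(** A polynomial with nonzero constant term is coprime to X; cancelling it stands in for division of
    power series. *)
Lemma eqX_mulI m r p q : r`_0 != 0 -> eqX m (r * p) (r * q) -> eqX m p q.
Proof.
move=> r0; rewrite /eqX -mulrBr Gauss_dvdpr // coprimep_expl //.
by rewrite coprimep_sym coprimepX rootE horner_coef0.
Qed.

Lemma eqX_comp m a p q :
  (0 < a)%N -> eqX m p q -> eqX m (p \Po 'X^a) (q \Po 'X^a).
Proof.
move=> a0 pq; rewrite /eqX -rmorphB /=.
apply: dvdp_trans (dvdp_comp_poly 'X^a pq).
by rewrite comp_Xn_poly -exprM dvdp_exp2l // leq_pmull.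
Qed.

Lemma addF2 p : p + p = 0.
Proof.
apply/polyP => i; rewrite coefD coef0; apply: val_inj.
by case: (p`_i) => [[|[|]]].
Qed.

Lemma subF2 p q : p - q = p + q.
Proof. by apply/eqP; rewrite subr_eq -addrA addF2 addr0. Qed.

(** The first [m] factors of f_a, enough modulo X^m when [a] is positive; signs disappear in
    characteristic 2. *)
Definition eulerX (m a : nat) : {poly 'F_2} := \prod_(k < m) (1 + 'X^(a * k.+1)).

Lemma prodX_coef0 n (e : nat -> nat) :
  (forall i, (0 < e i)%N) -> (\prod_(i < n) (1 + 'X^(e i)) : {poly 'F_2})`_0 = 1.
Proof.
move=> e0; elim/big_rec: _ => [|i p _ IHp]; first by rewrite coef1.
by rewrite coef0M IHp coefD coef1 coefXn mulr1 (ltn_eqF (e0 i)) addr0.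
Qed.

Lemma eulerX_neq0 m a : (0 < a)%N -> (eulerX m a)`_0 != 0.
Proof.
move=> a0; rewrite (prodX_coef0 m (e := fun k => a * k.+1)%N) ?oner_neq0 //.
by move=> i; rewrite muln_gt0 a0.
Qed.

Lemma eqX_prod_widen m n (e : nat -> nat) :
  (m <= n)%N -> (forall i, (m <= i)%N -> (m <= e i)%N) ->
  eqX m (\prod_(i < n) (1 + 'X^(e i))) (\prod_(i < m) (1 + 'X^(e i))).
Proof.
move=> mn eP; rewrite -(subnKC mn); elim: (n - m)%N => [|k IHk].
  by rewrite addn0 eqX_refl.
rewrite addnS big_ord_recr /= -[X in eqX _ _ X]mulr1; apply: eqX_mul => //.
apply/eqXP => i im; rewrite coefD coefXn ltn_eqF ?addr0 //=.
by rewrite (leq_trans im) // eP // leq_addr.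
Qed.

Lemma eulerX_sqr m a : eulerX m a ^+ 2 = eulerX m (a * 2)%N.
Proof.
rewrite /eulerX -prodrXl; apply: eq_bigr => k _.
have -> : 'X^(a * 2 * k.+1) = 'X^(a * k.+1) ^+ 2 :> {poly 'F_2}.
  by rewrite -exprM; congr ('X^_); lia.
set y := 'X^_; have -> : (1 + y) ^+ 2 = 1 + y ^+ 2 + (y + y) by ring.
by rewrite addF2 addr0.
Qed.

Lemma eulerX_comp m a b : eulerX m a \Po 'X^b = eulerX m (a * b)%N.
Proof.
rewrite /eulerX rmorph_prod; apply: eq_bigr => k _ /=.
by rewrite rmorphD rmorph1 /= comp_Xn_poly -exprM mulnCA mulnA.
Qed.

(** The summation index runs from -2m to 2m, so that for positive [b] and [c] the terms of degree
    below [m] stay more than [m] away from both ends. *)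
Definition thetaX (m b c : nat) : {poly 'F_2} :=
  \sum_(j < (2 * m + 2 * m).+1) 'X^(theta_exp b c (2 * m) j).

Lemma theta_exp_ge b c M j : (0 < b)%N -> (0 < c)%N ->
  (M - j <= theta_exp b c M j)%N /\ (j - M <= theta_exp b c M j)%N.
Proof. by rewrite /theta_exp; nia. Qed.

(** Times [eulerX m (b + c)], a Gaussian binomial of the finite identity is 1 modulo X^m, unless its
    theta monomial already vanishes there. *)
Lemma jacobi m b c : (0 < b)%N -> (0 < c)%N ->
  eqX m (\prod_(i < m) (1 + 'X^((b + c) * i + b))
         * \prod_(i < m) (1 + 'X^((b + c) * i + c)) * eulerX m (b + c))
        (thetaX m b c).
Proof.
move=> b0 c0; have m2 : (m <= 2 * m)%N by lia.
have ei (i : nat) : (i <= (b + c) * i)%N by rewrite leq_pmull // addn_gt0 b0.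
have w (d : nat) := @eqX_prod_widen m (2 * m) (fun i => (b + c) * i + d)%N m2 
  (fun i mi => leq_trans mi (leq_trans (ei i) (leq_addr _ _))).
apply: eqX_trans (eqX_mul (eqX_mul (eqX_sym (w b)) (eqX_sym (w c))) (eqX_refl m _)) _.
rewrite -finite_jacobi mulr_suml /eqX -sumrB.
apply: (big_ind (fun p => 'X^m %| p)) => [||j _]; first exact: dvdp0.
  by move=> p q; apply: dvdp_add.
rewrite -/(eqX _ _ _) mulrAC; case: (leqP m (theta_exp b c (2 * m) j)) => [me|em].
  by rewrite /eqX dvdp_sub ?dvdp_mull ?dvdp_exp2l.
have [e1 e2] := theta_exp_ge (2 * m) j b0 c0.
rewrite -[X in eqX _ _ X]mul1r; apply: eqX_mul; last exact: eqX_refl.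
have mj : (m <= j)%N by lia.
have wj := @eqX_prod_widen m j (fun i => (b + c) * i.+1)%N mj
  (fun i mi => leq_trans mi (leq_trans (leqnSn i) (ei i.+1))).
apply: eqX_trans (eqX_mul (eqX_refl m _) (eqX_sym wj)) _.
have := @qbinom_fact _ ('X^(b + c) : {poly 'F_2}) (2 * m + 2 * m) j.
rewrite -ltnS ltn_ord => /(_ isT).
under eq_bigr => k _ do rewrite subF2 -exprM.
(* Each factor left is 1 - q^(4m - i) with i < j < 3m, hence 1 modulo X^m. *)
move=> ->; elim/big_rec: _ => [|i p _ IHp]; first exact: eqX_refl.
rewrite -[X in eqX _ _ X]mulr1; apply: eqX_mul => //.
rewrite /eqX addrAC subrr add0r dvdpNr -exprM dvdp_exp2l //.
by apply: leq_trans (ei _); have := ltn_ord i; lia.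
Qed.

End TruncatedSeries.

(** * Theta series modulo 2 for f_1, f_1^3 and f_3^3 / f_1 *)

Section ThetaProducts.

Local Open Scope ring_scope.

Definition progX (m a r : nat) : {poly 'F_2} := \prod_(i < m) (1 + 'X^(a * i + r)).

Lemma prod_blocks (R : comPzRingType) (F : nat -> R) a m :
  \prod_(k < a * m) F k = \prod_(i < m) \prod_(j < a) F (a * i + j)%N.
Proof.
elim: m => [|m IHm]; first by rewrite muln0 !big_ord0.
by rewrite mulnSr big_split_ord big_ord_recr IHm.
Qed.

Lemma eulerX_progX m a : eulerX m a = progX m a a.
Proof. by apply: eq_bigr => i _; rewrite mulnSr. Qed.

Lemma eulerX_split m a n : (0 < a)%N -> (0 < n)%N ->
  eqX m (eulerX m a) (\prod_(j < n) progX m (a * n) (a * j.+1)).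
Proof.
move=> a0 n0; rewrite exchange_big /=.
have mn : (m <= n * m)%N by rewrite leq_pmull.
have w := @eqX_prod_widen m (n * m) (fun i => a * i.+1)%N mn.
apply: eqX_trans (eqX_sym (w _)) _ => [i mi|].
  by rewrite (leq_trans mi) // (leq_trans (leqnSn i)) // leq_pmull.
rewrite (@prod_blocks _ (fun k => 1 + 'X^(a * k.+1))).
rewrite [X in eqX _ X _](_ : _ =
  \prod_(i < m) \prod_(j < n) (1 + 'X^(a * n * i + a * j.+1))).
  exact: eqX_refl.
by apply: eq_bigr => i _; apply: eq_bigr => j _; rewrite -mulnA -mulnDr addnS.
Qed.

(** Euler's pentagonal number theorem: the triple product with b = 1, c = 2 covers all residues
    modulo 3. *)
Lemma pentagonalX m : eqX m (thetaX m 1 2) (eulerX m 1).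
Proof.
apply: eqX_trans (eqX_sym (@jacobi m 1 2 isT isT)) _.
rewrite -!/(progX _ _ _) eulerX_progX.
apply: eqX_trans (eqX_sym (@eulerX_split m 1 3 isT isT)).
by rewrite !big_ord_recr big_ord0 /= mul1r; apply: eqX_refl.
Qed.

(** Jacobi's identity; the exponents 2 t^2 - t are the triangular numbers. The triple product covers
    the residues 1, 3, 4 modulo 4, and multiplication by f_2 turns both sides into f_1 f_4. *)
Lemma triangularX m : eqX m (thetaX m 1 3) (eulerX m 1 ^+ 3).
Proof.
have f0 : (eulerX m 2)`_0 != 0 by apply: eulerX_neq0.
apply: (eqX_mulI f0).
have s1 := @eulerX_split m 1 4 isT isT; have s2 := @eulerX_split m 2 2 isT isT.
have j := eqX_sym (@jacobi m 1 3 isT isT).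
apply: eqX_trans (eqX_mul s2 j) _.
have -> : eulerX m 2 * eulerX m 1 ^+ 3 = eulerX m 1 * eulerX m 4.
  by rewrite -(eulerX_sqr m 2) -(eulerX_sqr m 1); ring.
apply: eqX_trans (eqX_mul (eqX_sym s1) (eqX_refl m _)).
rewrite -!/(progX _ _ _) !big_ord_recr !big_ord0 /= !mul1r !(muln1, mul1n).
rewrite -[(2 * 2)%N]/4%N -[(1 + 3)%N]/4%N.
by apply: (@eq_ind _ _ (eqX m ^~ _) (eqX_refl m _)); ring.
Qed.

(** f_3^3 / f_1 is the generating function of 3-cores. The triple product covers the residues 1, 5,
    6 modulo 6; multiplied by f_1 f_3, both sides become f_1 f_6^2. *)
Lemma coreX m : eqX m (eulerX m 1 * thetaX m 1 5) (eulerX m 3 ^+ 3).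
Proof.
have f0 : (eulerX m 1 * eulerX m 3)`_0 != 0.
  by rewrite coef0M mulf_neq0 // eulerX_neq0.
apply: (eqX_mulI f0).
have s1 := @eulerX_split m 1 6 isT isT; have s2 := @eulerX_split m 2 3 isT isT.
have s3 := @eulerX_split m 3 2 isT isT.
have j := eqX_sym (@jacobi m 1 5 isT isT).
have -> : eulerX m 1 * eulerX m 3 * (eulerX m 1 * thetaX m 1 5)
        = eulerX m 2 * eulerX m 3 * thetaX m 1 5.
  by rewrite -(eulerX_sqr m 1); ring.
have -> : eulerX m 1 * eulerX m 3 * eulerX m 3 ^+ 3
        = eulerX m 1 * (eulerX m 6 * eulerX m 6).
  by rewrite -(eulerX_sqr m 3); ring.
apply: eqX_trans (eqX_mul (eqX_mul s2 s3) j) _.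
apply: eqX_trans (eqX_mul (eqX_sym s1) (eqX_refl m _)).
rewrite -!/(progX _ _ _) !big_ord_recr !big_ord0 /= !mul1r !(muln1, mul1n).
rewrite -[(2 * 2)%N]/4%N -[(2 * 3)%N]/6%N -[(3 * 2)%N]/6%N -[(1 + 5)%N]/6%N.
rewrite (eulerX_progX m 6).
by apply: (@eq_ind _ _ (eqX m ^~ _) (eqX_refl m _)); ring.
Qed.

End ThetaProducts.

(** * The generating function of regular partitions *)

Section RegularPartitions.

Variable l : nat.

(** Partitions with parts at most [j]: first those without a part [j], then those with one. [t] is
    fuel; both calls lower [j + n], so [j + n <= t] suffices. *)
Fixpoint regular_partitions (t j n : nat) : seq (seq nat) :=
  match t, j with
  | t'.+1, j'.+1 =>
    regular_partitions t' j' n ++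
    (if (j <= n) && ~~ (l %| j)
     then [seq j :: s | s <- regular_partitions t' j (n - j)] else [::])
  | _, _ => if n == 0 then [:: [::]] else [::]
  end.

Lemma mem_regular_partitions t j n s : j + n <= t ->
  (s \in regular_partitions t j n)
  = is_regular_partition l n s && all (fun k => k <= j) s.
Proof.
elim: t j n s => [|t IHt] [|j] n s //= jnt.
- have -> : n = 0 by lia.
  case: s => [|[|a] s] //;
  by rewrite /is_regular_partition /is_partition /= ?andbF ?inE.
- case: s => [|a s] /=.
    by rewrite /is_regular_partition /is_partition /= eq_sym; case: n {jnt}.
  case: a => [|a]; rewrite /is_regular_partition /is_partition /= ?andbF ?inE;
  by case: (n == 0).
rewrite mem_cat IHt; last by move: jnt; clear; lia.
have -> : (s \in (if (j < n) && ~~ (l %| j.+1)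
     then [seq j.+1 :: s | s <- regular_partitions t j.+1 (n - j.+1)] else [::]))
   = (if s is a :: s' then
     [&& a == j.+1, j < n, ~~ (l %| j.+1), is_regular_partition l (n - j.+1) s'
      & all (fun k => k <= j.+1) s'] else false).
  case: ifP => [/andP[jn lj]|jn]; last first.
    rewrite in_nil; case: s => // a s; move: jn; case: (a == _) => //=.
    by case: (j < n) => //= ->.
  apply/mapP/idP => [[s' s'P ->]|].
    by rewrite eqxx jn lj /= -(IHt j.+1) //; lia.
  case: s => // a s /and3P[/eqP -> _ /andP[_ sP]].
  by exists s => //; rewrite (IHt j.+1) //; lia.
case: s => [|a s]; first by rewrite /= !andbT orbF.
have tr : transitive geq by move=> x y z yx zx; apply: leq_trans zx yx.
rewrite /is_regular_partition /is_partition /= !path_sortedE // !inE !negb_or.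
case: (ltngtP a j.+1) => aj.
- rewrite -(ltnS a) aj /= orbF.
  case: (boolP (all (geq a) s)) => //= /allP sa.
  have -> : all (fun k => k <= j) s.
    by apply/allP => k /sa /= ka; apply: leq_trans ka _.
  have -> // : all (fun k => k <= j.+1) s.
  by apply/allP => k /sa /= ka; apply: leq_trans ka _; apply: ltnW.
- by rewrite (leqNgt a j) (ltnW aj) /= !andbF.
rewrite aj ltnn /= !andbF /=.
have -> : (j.+1 + sumn s == n) = (j < n) && (sumn s == n - j.+1).
  by apply/idP/idP; lia.
have -> : all (geq j.+1) s = all (fun k => k <= j.+1) s by apply: eq_all.
move: (all (fun k => k <= j.+1) s) (all (fun k => ~~ (l %| k)) s) (sorted geq s).
move: (j < n) (0 \notin s) (l %| j.+1) (sumn s == _).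
by do 7!case.
Qed.

Lemma uniq_regular_partitions t j n : j + n <= t -> uniq (regular_partitions t j n).
Proof.
elim: t j n => [|t IHt] [|j] n //= jnt; try by case: ifP.
rewrite cat_uniq IHt /=; last by lia.
case: ifP => //= /andP[jn _]; rewrite map_inj_uniq; last by move=> x y [].
rewrite IHt ?andbT; last by lia.
apply/hasPn => _ /mapP[s _ ->]; rewrite mem_regular_partitions; last by lia.
by rewrite /= ltnn !andbF.
Qed.

Lemma num_regular_partitionsE t j n : n <= j -> j + n <= t ->
  num_regular_partitions l n = size (regular_partitions t j n).
Proof.
move=> nj jnt; apply: num_regular_partitionsP => [|s].
  exact: uniq_regular_partitions.
rewrite mem_regular_partitions //; case: (boolP (is_regular_partition _ _ _)) => //=.
case/andP => /and3P[_ _ /eqP sn _]; apply/allP => k ks.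
apply: leq_trans nj; rewrite -sn.
elim: s ks {sn} => //= a s IHs; rewrite inE => /orP[/eqP ->|/IHs]; lia.
Qed.

Local Open Scope ring_scope.

Definition geomX (m k : nat) : {poly 'F_2} := \sum_(i < m) 'X^(k * i).

Lemma geomX_mul m k : (0 < k)%N -> eqX m (geomX m k * (1 + 'X^k)) 1.
Proof.
move=> k0; have -> : geomX m k * (1 + 'X^k) = 1 + 'X^(k * m).
  rewrite /geomX; elim: m => [|m IHm].
    by rewrite big_ord0 muln0 expr0 addF2 mul0r.
  rewrite big_ord_recr mulrDl IHm /= mulrDr mulr1 -exprD -mulnSr.
  by rewrite addrA -(addrA 1) addF2 addr0.
apply/eqXP => i im; rewrite coefD coefXn ltn_eqF ?addr0 //.
by rewrite (leq_trans im) // leq_pmull.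
Qed.

Definition regularX (m j : nat) : {poly 'F_2} :=
  \prod_(k < j | ~~ (l %| k.+1)%N) geomX m k.+1.

(** Multiplying by 1 + X^(j + 1) undoes the last geometric series, which is the recursion of
    [regular_partitions] modulo 2. *)
Lemma regularX_coef m t j n : (j + n <= t)%N -> (n < m)%N ->
  (regularX m j)`_n = (size (regular_partitions t j n))%:R.
Proof.
elim: t j n => [|t IHt] [|j] n //= jnt nm.
- by rewrite /regularX big_ord0 coef1; case: (n == 0%N).
- by rewrite /regularX big_ord0 coef1; case: (n == 0%N).
rewrite size_cat natrD -(IHt j n) //.
rewrite [regularX m j.+1]big_mkcond big_ord_recr -big_mkcond -/(regularX m j) /=.
case: (boolP (l %| j.+1)%N) => lj; first by rewrite andbF mulr1 addr0.
rewrite andbT.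
have /eqXP/(_ n nm) : eqX m (regularX m j.+1 * (1 + 'X^(j.+1))) (regularX m j).
  rewrite /regularX big_mkcond big_ord_recr -big_mkcond lj /= -mulrA.
  rewrite -[X in eqX _ _ X]mulr1; apply: eqX_mul (eqX_refl _ _) _.
  exact: geomX_mul.
have E : regularX m j.+1 = regularX m j * geomX m j.+1.
  by rewrite /regularX big_mkcond big_ord_recr -big_mkcond lj.
rewrite -E mulrDr mulr1 coefD coefMXn => <-.
case: ltnP => jn; first by rewrite !addr0.
rewrite size_map -IHt; [|lia..].
by rewrite -addrA -mulr2n -mulr_natr (_ : 2%:R = 0) ?mulr0 ?addr0 //; apply: val_inj.
Qed.

(** Each geometric series cancels its factor of f_1; the factors of index divisible by [l], exactly
    [m] among the first [l * m], remain and form f_l. *)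
Lemma regularX_eulerX m : (0 < l)%N ->
  eqX m (regularX m (l * m) * eulerX m 1) (eulerX m l).
Proof.
move=> l0.
have w := @eqX_prod_widen m (l * m) (fun i => 1 * i.+1)%N (leq_pmull m l0).
apply: eqX_trans (eqX_mul (eqX_refl m _) (eqX_sym (w _))) _ => [i mi|].
  by rewrite mul1n leqW.
rewrite (bigID (fun k : 'I__ => ~~ (l %| k.+1)%N)) /= mulrA.
rewrite -[X in eqX _ _ X]mul1r; apply: eqX_mul.
  rewrite /regularX -big_split /=.
  elim/big_rec: _ => [|k p _ IHp]; first exact: eqX_refl.
  by rewrite -[1 in X in eqX _ _ X]mulr1; apply: eqX_mul => //; rewrite mul1n geomX_mul.
rewrite big_mkcond (@prod_blocks _ (fun k =>
  if ~~ ~~ (l %| k.+1)%N then 1 + 'X^(1 * k.+1) else 1)).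
apply: (@eq_ind _ _ (eqX m ^~ _) (eqX_refl m _)); apply: eq_bigr => i _.
case: l l0 => // l' _; rewrite big_ord_recr big1 /= ?mul1r => [|j _].
  by rewrite negbK -addnS -mulnSr dvdn_mulr ?mul1n.
rewrite negbK -addnS dvdn_addr ?dvdn_mulr // gtnNdvd //.
by rewrite ltnS ltn_ord.
Qed.

End RegularPartitions.

(** * Counting pairs of integers *)

Section Counting.

Lemma count_bij (A B : eqType) (sA : seq A) (sB : seq B) (P : pred A) (Q : pred B)
    (h : A -> B) (g : B -> A) :
  uniq sA -> uniq sB ->
  (forall a, a \in sA -> P a -> [/\ h a \in sB, Q (h a) & g (h a) = a]) ->
  (forall b, b \in sB -> Q b -> [/\ g b \in sA, P (g b) & h (g b) = b]) ->
  count P sA = count Q sB.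
Proof.
move=> uA uB hP gP; rewrite -!size_filter -(size_map h); apply/perm_size/uniq_perm.
- rewrite map_inj_in_uniq ?filter_uniq // => a a'.
  rewrite !mem_filter => /andP[Pa Aa] /andP[Pa' Aa'] E.
  by have [[_ _ <-] [_ _ <-]] := (hP _ Aa Pa, hP _ Aa' Pa'); rewrite E.
- exact: filter_uniq.
move=> b; rewrite mem_filter; apply/mapP/andP => [[a]|[Qb Bb]].
  by rewrite mem_filter => /andP[Pa Aa] ->; have [] := hP _ Aa Pa.
have [gA Pg hg] := gP _ Bb Qb.
by exists (g b); rewrite // mem_filter Pg.
Qed.

(** The points that [f] moves pair off; the induction removes the head of the list together with its
    image. *)
Lemma odd_size_involution (T : eqType) (s : seq T) (f : T -> T) :
  uniq s -> (forall x, x \in s -> f x \in s /\ f (f x) = x) ->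
  odd (size s) = odd (count (fun x => f x == x) s).
Proof.
have [n] := ubnP (size s); elim: n s => // n IHn [|x s] //= sn /andP[xs us] fP.
have [fx ffx] := fP x (mem_head _ _).
have sub y : y \in s -> y \in x :: s by rewrite inE orbC => ->.
have fs y : y \in s -> f y = x -> y = f x.
  by move=> ys <-; have [_ ->] := fP y (sub y ys).
have fs' y : y \in s -> f (f y) = y by move=> /sub/fP[].
case: eqP => [fxx|fxx].
  rewrite oddD -IHn // => y ys; split; last exact: fs'.
  have [] := fP y (sub y ys); rewrite inE => /orP[/eqP fyx|//] _.
  by move: xs; rewrite -[x]fxx -(fs y) // ys.
have {}fx : f x \in s by move: fx; rewrite inE => /orP[/eqP|].
have sE := perm_to_rem fx.
rewrite add0n (perm_size sE) (permP sE) /= ffx eq_sym (introF eqP fxx) add0n.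
rewrite negbK IHn ?rem_uniq //.
  by have /= := perm_size sE; lia.
move=> y; rewrite !mem_rem_uniq // !inE => /andP[yfx ys].
have [] := fP y (sub y ys); rewrite inE => /orP[/eqP fyx|fys] ffy.
  by rewrite (fs _ ys fyx) eqxx in yfx.
split=> //; rewrite fys andbT; apply: contraNneq xs => E.
by rewrite -(_ : y = x) // -[LHS]ffy E.
Qed.

Lemma odd_count_involution (T : eqType) (s : seq T) (P : pred T) (f : T -> T) :
  uniq s -> (forall x, x \in s -> P x -> [/\ f x \in s, P (f x) & f (f x) = x]) ->
  odd (count P s) = odd (count (fun x => P x && (f x == x)) s).
Proof.
move=> us fP; rewrite -size_filter (@odd_size_involution _ _ f) ?filter_uniq //.
  by rewrite count_filter; congr (odd _); apply: eq_count => x /=; rewrite andbC.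
by move=> x; rewrite !mem_filter => /andP[Px xs]; have [-> ->] := fP x xs Px.
Qed.

Definition int_range (B : nat) : seq int :=
  [seq (Posz i - Posz B)%R | i <- iota 0 (2 * B).+1].

Definition int_box (B : nat) : seq (int * int) :=
  [seq (x, y) | x <- int_range B, y <- int_range B].

Arguments int_range : simpl never.
Arguments int_box : simpl never.

Lemma mem_int_range B x : (x \in int_range B) = (`|x|%N <= B).
Proof.
apply/mapP/idP => [[i]|xB]; first by rewrite mem_iota; lia.
by exists `|(x + Posz B)%R|%N; rewrite ?mem_iota; lia.
Qed.

Lemma uniq_int_range B : uniq (int_range B).
Proof. by rewrite map_inj_uniq ?iota_uniq // => i j; lia. Qed.

Lemma mem_int_box B x y : ((x, y) \in int_box B) = (`|x|%N <= B) && (`|y|%N <= B).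
Proof.
rewrite -!mem_int_range; apply/allpairsP/andP => [[[u v] [/= ? ? [-> ->]]]|[]] //.
by exists (x, y).
Qed.

Lemma uniq_int_box B : uniq (int_box B).
Proof. by apply: allpairs_uniq; rewrite ?uniq_int_range // => -[? ?] [? ?]. Qed.

End Counting.

(** * The terms of exponent 4 n + 1 *)

Section Dissection.

Local Open Scope ring_scope.

Definition theta_expz (b c : nat) (t : int) : nat :=
  match t with
  | Posz n => (b + c) * 'C(n, 2) + b * n
  | Negz n => (b + c) * 'C(n.+1, 2) + c * n.+1
  end%N.

Lemma theta_expzE b c t :
  2 * Posz (theta_expz b c t) = (Posz b + Posz c) * t ^+ 2 + (Posz b - Posz c) * t.
Proof.
have bin2E k : ('C(k, 2) * 2 + k = k * k)%N.
  by elim: k => // k IHk; rewrite binS bin1; lia.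
case: t => k /=; first by have := bin2E k; nia.
by have := bin2E k.+1; rewrite NegzE; nia.
Qed.

Lemma thetaXE m b c :
  thetaX m b c = \sum_(t <- int_range (2 * m)) 'X^(theta_expz b c t).
Proof.
rewrite /int_range big_map /thetaX.
rewrite -(big_mkord xpredT (fun j => 'X^(theta_exp b c (2 * m) j))) /index_iota subn0.
rewrite addnn -mul2n; apply: eq_bigr => j _; congr ('X^_).
rewrite /theta_exp; have [jm|mj] := leqP (2 * m) j.
  have [k ->] : exists k, (j = 2 * m + k)%N by exists (j - 2 * m)%N; lia.
  have -> : Posz (2 * m + k) - Posz (2 * m) = Posz k by lia.
  have [-> ->] : (2 * m + k - 2 * m = k /\ 2 * m - (2 * m + k) = 0)%N by lia.
  by rewrite bin0n !muln0 !addn0.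
have [k mE] : exists k, (2 * m = j + k.+1)%N by exists (2 * m - j.+1)%N; lia.
have -> : Posz j - Posz (2 * m) = Negz k by lia.
have [-> ->] : (j - 2 * m = 0 /\ 2 * m - j = k.+1)%N by lia.
by rewrite bin0n !muln0 !add0n.
Qed.

Lemma thetaX_mul_coef m a b c b' c' n :
  ((thetaX m b c \Po 'X^a) * thetaX m b' c')`_n =
  (count (fun v => (a * theta_expz b c v.1 + theta_expz b' c' v.2)%N == n)
     (int_box (2 * m)))%:R.
Proof.
rewrite -sum1_count big_mkcond [int_box _]/int_box big_allpairs.
rewrite !thetaXE rmorph_sum /= mulr_suml coef_sum natr_sum; apply: eq_bigr => s _ /=.
rewrite mulr_sumr coef_sum natr_sum; apply: eq_bigr => t _ /=.
rewrite comp_Xn_poly -exprM -exprD coefXn eq_sym.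
by case: (_ == n).
Qed.

Lemma thetaX_coef m a b c n :
  (thetaX m b c \Po 'X^a)`_n =
  (count (fun t => (a * theta_expz b c t)%N == n) (int_range (2 * m)))%:R.
Proof.
rewrite -sum1_count big_mkcond natr_sum thetaXE rmorph_sum /= coef_sum.
apply: eq_bigr => t _ /=; rewrite comp_Xn_poly -exprM coefXn eq_sym.
by case: (_ == n).
Qed.

Definition section4 (p : {poly 'F_2}) : {poly 'F_2} :=
  \poly_(i < size p) p`_(4 * i + 1).

Lemma coef_section4 p i : (section4 p)`_i = p`_(4 * i + 1).
Proof.
rewrite coef_poly; case: ltnP => // pi; rewrite nth_default //.
by apply: leq_trans pi _; lia.
Qed.

Lemma eqX_section4 m p q : eqX (4 * m) p q -> eqX m (section4 p) (section4 q).
Proof. by move=> /eqXP pq; apply/eqXP => i im; rewrite !coef_section4 pq //; lia. Qed.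

(** A factor in X^4 preserves exponents modulo 4, so it commutes with the extraction of one residue
    class. *)
Lemma section4_mul p q : section4 (p * (q \Po 'X^4)) = section4 p * q.
Proof.
rewrite comp_polyE.
transitivity (section4 p * \sum_(i < size q) q`_i *: 'X^i); last first.
  by rewrite -poly_def coefK.
rewrite !mulr_sumr; apply/polyP => n; rewrite coef_section4 !coef_sum.
apply: eq_bigr => -[i /= _] _.
rewrite -exprM -!scalerAr !coefZ !coefMXn coef_section4.
case: ltnP => [ni|ni]; first by rewrite ltnNge (_ : _ <= _ = false)%N //; lia.
rewrite ltnNge (_ : (i <= n)%N) /=; last by lia.
by congr (_ * p`_ _); lia.
Qed.

Lemma sqr_parity (c : int) : (2 %| c ^+ 2 - c)%Z.
Proof.
have [a [->|->]] : exists a, c = 2 * a \/ c = 2 * a + 1.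
- by exists (c %/ 2)%Z; lia.
- by rewrite (_ : _ - _ = 2 * (2 * a ^+ 2 - a)) ?dvdz_mulr //; ring.
- by rewrite (_ : _ - _ = 2 * (2 * a ^+ 2 + a)) ?dvdz_mulr //; ring.
Qed.

Lemma absz_le_sqr (x : int) : Posz `|x|%N <= x ^+ 2.
Proof. by nia. Qed.

(** With x = 6 s - 1 and y = 4 t - 1, both odd, (3 x + y)(3 x - y) = 16 (x^2 - 2 n - 1) is divisible
    by 32. Both factors are even and their sum 6 x is 2 modulo 4, so one is 2 modulo 4 and 16
    divides the other. *)
Lemma norm7_dvd (s t : int) (n : nat) :
  7 * (6 * s - 1) ^+ 2 + (4 * t - 1) ^+ 2 = 16 * (2 * Posz n + 1) ->
  (16 %| 3 * (6 * s - 1) + (4 * t - 1))%Z || (16 %| 3 * (6 * s - 1) - (4 * t - 1))%Z.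
Proof.
move=> N.
have dvd4 (A q Z : int) : A * (2 * q - 1) = 4 * Z -> (4 %| A)%Z.
  move=> E; rewrite (_ : A = 4 * (q * (A * q - 2 * Z) - Z)) ?dvdz_mulr //.
  have -> : 4 * (q * (A * q - 2 * Z) - Z)
    = A + (A * (2 * q - 1) - 4 * Z) * (2 * q + 1) by ring.
  by rewrite E subrr mul0r addr0.
have E : 16 * ((6 * s - 1) ^+ 2 - 2 * Posz n - 1)
    = (3 * (6 * s - 1) + (4 * t - 1)) * (3 * (6 * s - 1) - (4 * t - 1)).
  by nia.
have [r [sE|sE]] : exists r, s = 2 * r \/ s = 2 * r + 1.
- by exists (s %/ 2)%Z; lia.
- have := @dvd4 (9 * r + t - 1) (9 * r - t) (72 * r ^+ 2 - 12 * r - Posz n).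
  by rewrite sE in E *; move=> H; apply/orP; left; have {}H := H ltac:(nia); lia.
have := @dvd4 (9 * r + 4 - t) (9 * r + t + 4) (72 * r ^+ 2 + 60 * r + 12 - Posz n).
by rewrite sE in E *; move=> H; apply/orP; right; have {}H := H ltac:(nia); lia.
Qed.

(* In [Z[(1 + sqrt (-7)) / 2]] the solutions are [(y + x sqrt (-7)) / 2 = pi ^ 2
   * (c + d sqrt (-7))], up to signs, where [pi ^ 2 = (-3 + sqrt (-7)) / 2] and
   [c ^ 2 + 7 d ^ 2 = 2 n + 1]; the involution [d |-> - d] fixes [d = 0]. *)
Lemma odd_count_norm7 B n : (8 * n + 8 <= B)%N ->
  odd (count (fun v => 21 * theta_expz 1 2 v.1 + theta_expz 1 3 v.2 == 4 * n + 1)%N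
         (int_box B))
  = odd (count (fun t => 12 * theta_expz 1 2 t == n)%N (int_range B)).
Proof.
move=> nB.
have E12 t := theta_expzE 1 2 t; have E13 t := theta_expzE 1 3 t.
pose Q (v : int * int) :=
  (v.1 ^+ 2 + 7 * v.2 ^+ 2 == 2 * Posz n + 1) && (3 %| v.1 + 1)%Z.
(* [h] inverts x = c - 3 d, y' = - (3 c + 7 d), where y' is the one of y, -y for which 16 divides 3
   x + y'. In [g], the sign of y puts it in the class -1 modulo 4. *)
pose h (v : int * int) : int * int :=
  let x := 6 * v.1 - 1 in let y := 4 * v.2 - 1 in
  let y' := if (16 %| 3 * x + y)%Z then y else - y in
  let d := ((- (y' + 3 * x)) %/ 16)%Z in (x + 3 * d, d).
pose g (v : int * int) : int * int :=
  let x := v.1 - 3 * v.2 in let y := 3 * v.1 + 7 * v.2 in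
  let y' := if (4 %| y + 1)%Z then y else - y in
  (((x + 1) %/ 6)%Z, ((y' + 1) %/ 4)%Z).
have PE s t : (21 * theta_expz 1 2 s + theta_expz 1 3 t == 4 * n + 1)%N
  = (7 * (6 * s - 1) ^+ 2 + (4 * t - 1) ^+ 2 == 16 * (2 * Posz n + 1)).
  have := E12 s; have := E13 t.
  move: (theta_expz 1 2 s) (theta_expz 1 3 t) => e1 e2 H1 H2.
  by apply/idP/idP => /eqP H; apply/eqP; nia.
rewrite (@count_bij _ _ _ (int_box B) _ Q h g) ?uniq_int_box //; first last.
- move=> [c d] _ /andP[/= /eqP N c3].
  have [k cd] : exists k, c + d = 2 * k + 1.
    have := sqr_parity c; have := sqr_parity d.
    by exists ((c + d - 1) %/ 2)%Z; lia.
  rewrite /g /=; set y' := if _ then _ else _.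
  have y4 : (4 %| y' + 1)%Z by rewrite /y'; case: ifP; lia.
  have yy : y' = 3 * c + 7 * d \/ y' = - (3 * c + 7 * d).
    by rewrite /y'; case: ifP; auto.
  have [t tE] : exists t, y' = 4 * t - 1 by exists ((y' + 1) %/ 4)%Z; lia.
  have [s sE] : exists s, c - 3 * d = 6 * s - 1 by exists ((c - 3 * d + 1) %/ 6)%Z; lia.
  have -> : ((c - 3 * d + 1) %/ 6)%Z = s by lia.
  have -> : ((y' + 1) %/ 4)%Z = t by lia.
  have N' : 7 * (6 * s - 1) ^+ 2 + (4 * t - 1) ^+ 2 = 16 * (2 * Posz n + 1).
    by rewrite -N -sE -tE; case: yy => ->; ring.
  split.
    have := absz_le_sqr (6 * s - 1); have := absz_le_sqr (4 * t - 1).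
    move: N'; move: (_ ^+ 2) (_ ^+ 2) => X Y N' tY sX.
    by rewrite mem_int_box; apply/andP; split; lia.
    by rewrite PE N'.
  rewrite /h /= -tE -sE; move: yy; clearbody y'; clear -cd; case=> ->.
    rewrite ifF; last by lia.
    by rewrite (_ : - (_ + _) = d * 16) ?mulzK ?subrK //; ring.
  rewrite ifT; last by lia.
  by rewrite (_ : - (_ + _) = d * 16) ?mulzK ?subrK //; ring.
- move=> [s t] _; rewrite PE => /eqP N.
  have y16 := norm7_dvd N.
  rewrite /h /=; set y' := if _ then _ else _.
  have {}y16 : (16 %| 3 * (6 * s - 1) + y')%Z.
    by rewrite /y'; case: ifP y16 => //= _; rewrite mulrBr.
  have yy : y' = 4 * t - 1 \/ y' = - (4 * t - 1) by rewrite /y'; case: ifP; auto.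
  have N' : 7 * (6 * s - 1) ^+ 2 + y' ^+ 2 = 16 * (2 * Posz n + 1).
    by rewrite -N; case: yy => ->; rewrite ?sqrrN.
  have [d dE] : exists d, - (y' + 3 * (6 * s - 1)) = d * 16.
    by move: y16 => /dvdzP[q qE]; exists (- q); rewrite mulNr -qE addrC.
  rewrite dE mulzK //.
  have yE : y' = - (16 * d) - 3 * (6 * s - 1).
    by rewrite mulrC -dE opprK addrK.
  have Q' : (6 * s - 1 + 3 * d) ^+ 2 + 7 * d ^+ 2 = 2 * Posz n + 1.
    apply: (@mulfI _ 16) => //; rewrite -N' yE; ring.
  clear N N' PE E12 E13.
  split.
  - have := absz_le_sqr (6 * s - 1 + 3 * d); have := absz_le_sqr d.
    move: Q'; rewrite mem_int_box; move: (6 * s - 1 + 3 * d) => c.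
    by move: (_ ^+ 2) (_ ^+ 2) => X Y Q' dY cX; apply/andP; split; lia.
  - by rewrite /Q /= Q' eqxx; lia.
  rewrite /g /=; clearbody y'.
  have -> : 3 * (6 * s - 1 + 3 * d) + 7 * d = - y' by lia.
  by case: ifP => H; congr (_, _); lia.
rewrite (@odd_count_involution _ _ _ (fun v => (v.1, - v.2))) ?uniq_int_box //;
  last first.
  move=> [c d]; rewrite !mem_int_box abszN opprK => cd /andP[/= N c3].
  by rewrite /Q /= sqrrN N c3.
congr (odd _).
(* At a fixed point c^2 = 2 n + 1 with c = 6 t - 1, and c^2 - 1 is 24 times the pentagonal exponent
   at t. *)
apply: (@count_bij _ _ _ _ _ _ (fun v => ((v.1 + 1) %/ 6)%Z) (fun t => (6 * t - 1, 0))).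
- exact: uniq_int_box.
- exact: uniq_int_range.
- move=> [c d]; rewrite mem_int_box => cdB /andP[/andP[/= /eqP N c3] /eqP[dE]].
  have d0 : d = 0 by lia.
  subst d.
  have [t tE] : exists t, c = 6 * t - 1.
    by have := sqr_parity c; exists ((c + 1) %/ 6)%Z; lia.
  have -> : ((c + 1) %/ 6)%Z = t by lia.
  split; first by rewrite mem_int_range; lia.
    by apply/eqP; have := E12 t; rewrite tE in N; nia.
  by rewrite tE.
- move=> t; rewrite mem_int_range => tB /eqP N.
  have Q' : (6 * t - 1) ^+ 2 = 2 * Posz n + 1 by have := E12 t; nia.
  split.
  - have := absz_le_sqr (6 * t - 1); rewrite Q' mem_int_box => H.
    by apply/andP; split; lia.
  - by rewrite /Q /= oppr0 eqxx expr0n mulr0 addr0 Q' eqxx; lia.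
  - by rewrite /=; lia.
Qed.

End Dissection.

(** * The parity of b_21(4 n + 1) as a number of representations *)

Section Representations.

Local Open Scope ring_scope.

(** The class [s] of z modulo 3 is a parameter because multiplication by an element of norm p^2 may
    shift it. *)
Definition is_rep (s : int) (N : nat) (v : int * int) : bool :=
  [&& 8 * v.1 ^+ 2 + 3 * v.2 ^+ 2 == Posz N, (3 %| v.1 + 1)%Z & (3 %| v.2 - s)%Z].

Definition num_reps (s : int) (N : nat) : nat := count (is_rep s N) (int_box N).

Lemma natrF2_inj (a b : nat) : a%:R = b%:R :> 'F_2 -> odd a = odd b.
Proof.
move=> /(congr1 val); rewrite !Zp_nat /= !modn2.
by case: (odd a); case: (odd b).
Qed.

Lemma is_rep_box s N v : is_rep s N v -> v \in int_box N.
Proof.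
case: v => k z /and3P[/eqP /= N' _ _].
have := absz_le_sqr k; have := absz_le_sqr z; rewrite mem_int_box.
by move: N'; move: (_ ^+ 2) (_ ^+ 2) => X Y N' zY kX; apply/andP; split; lia.
Qed.

(** The identity f_12 / f_1 = f_3 (f_3^3 / f_1), checked after multiplication by f_1. The precision
    is 4 m because the extraction divides it by 4. *)
Lemma section4_regularX m K : K = (4 * m)%N ->
  eqX m (section4 (regularX 21 K (21 * K)))
        ((thetaX K 1 2 \Po 'X^3) * thetaX K 1 5).
Proof.
move=> KE; set D := regularX _ _ _.
have weaken p q : eqX K p q -> eqX m p q.
  by move=> /eqXP pq; apply/eqXP => i im; apply: pq; lia.
have e0 a : (0 < a)%N -> (eulerX K a)`_0 != 0 by apply: eulerX_neq0.
have Dgf : eqX K (D * eulerX K 4) ((thetaX K 1 2 \Po 'X^21) * thetaX K 1 3).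
  have -> : D * eulerX K 4 = (D * eulerX K 1) * eulerX K 1 ^+ 3.
    by rewrite -(eulerX_sqr K 2) -(eulerX_sqr K 1); ring.
  apply: eqX_mul; last exact: eqX_sym (triangularX K).
  apply: eqX_trans (@regularX_eulerX 21 K isT) _.
  by rewrite -(eulerX_comp K 1 21); apply: eqX_comp => //; apply/eqX_sym/pentagonalX.
have theta12 : eqX m (section4 ((thetaX K 1 2 \Po 'X^21) * thetaX K 1 3))
                     (thetaX K 1 2 \Po 'X^12).
  apply/eqXP => i im; rewrite coef_section4 thetaX_mul_coef thetaX_coef.
  set a := count _ _; set b := count _ _.
  have ab : odd a = odd b by apply: odd_count_norm7; lia.
  rewrite -(odd_double_half a) -(odd_double_half b) ab !natrD -!mul2n !natrM.
  have -> : 2%:R = 0 :> 'F_2 by apply: val_inj.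
  by rewrite !mul0r.
have f0 : (eulerX K 1)`_0 != 0 by apply: e0.
apply: (eqX_mulI f0).
(* f_4 is f_1 evaluated at X^4, so it leaves the extraction as f_1. *)
have -> : eulerX K 1 * section4 D = section4 (D * eulerX K 4).
  by rewrite -(eulerX_comp K 1 4) section4_mul mulrC.
apply: eqX_trans (eqX_section4 (_ : eqX (4 * m) _ _)) _.
  by rewrite -KE; exact: Dgf.
 apply: eqX_trans theta12 _; apply: weaken.
apply: eqX_trans (eqX_comp (isT : 0 < 12)%N (pentagonalX K)) _.
rewrite eulerX_comp; apply: eqX_sym.
rewrite mulrCA; have -> : eulerX K (1 * 12) = eulerX K 3 * eulerX K 3 ^+ 3.
  by rewrite -(eulerX_sqr K 6) -(eulerX_sqr K 3); ring.
apply: eqX_mul; last exact: coreX.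
by rewrite -(eulerX_comp K 1 3); apply: eqX_comp => //; apply: pentagonalX.
Qed.

(** Completing squares: the theta exponents e1 at s and e2 at t satisfy 24 (3 e1 + e2) + 11 = 8 (3 t
    - 1)^2 + 3 (6 s - 1)^2. Conversely z is odd, so z = -1 modulo 3 gives z = -1 modulo 6. *)
Lemma odd_b21 n : odd (b21 (4 * n + 1)) = odd (num_reps (-1) (24 * n + 11)).
Proof.
pose m := n.+1; pose K := (4 * m)%N.
have /eqXP/(_ n (leqnn _)) := @section4_regularX m K erefl.
rewrite coef_section4 (@regularX_coef 21 K (21 * K + (4 * n + 1))) //; last first.
  by rewrite /K /m; lia.
rewrite -num_regular_partitionsE //; last by rewrite /K /m; lia.
rewrite thetaX_mul_coef => /natrF2_inj ->; congr (odd _).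
have E12 t := theta_expzE 1 2 t; have E15 t := theta_expzE 1 5 t.
apply: (@count_bij _ _ _ _ _ _ (fun v => (3 * v.2 - 1, 6 * v.1 - 1))
  (fun v => (((v.2 + 1) %/ 6)%Z, ((v.1 + 1) %/ 3)%Z))).
- exact: uniq_int_box.
- exact: uniq_int_box.
- move=> [s t] _ /eqP /= N.
  have R : is_rep (-1) (24 * n + 11) (3 * t - 1, 6 * s - 1).
    apply/and3P; split; rewrite /=; [|lia|lia].
    by apply/eqP; have := E12 s; have := E15 t; nia.
  split=> //; first exact: is_rep_box R.
  by congr (_, _); lia.
move=> [k z] _ /and3P[/eqP /= N k3 z3].
have [t tE] : exists t, k = 3 * t - 1 by exists ((k + 1) %/ 3)%Z; lia.
have [s sE] : exists s, z = 6 * s - 1.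
  by have := sqr_parity z; exists ((z + 1) %/ 6)%Z; lia.
have -> : ((z + 1) %/ 6)%Z = s by lia.
have -> : ((k + 1) %/ 3)%Z = t by lia.
rewrite tE sE in N *; split=> //.
  have := absz_le_sqr (3 * t - 1); have := absz_le_sqr (6 * s - 1).
  move: N; move: (_ ^+ 2) (_ ^+ 2) => X Y N sY tX.
  by rewrite mem_int_box; apply/andP; split; rewrite /K /m; lia.
apply/eqP; have := E12 s; have := E15 t; move: N; rewrite /=.
move: (theta_expz 1 2 s) (theta_expz 1 5 t) => e1 e2 N e2E e1E.
have {}N : 24 * (3 * Posz e1 + Posz e2) = 24 * Posz n.
  have -> : 24 * (3 * Posz e1 + Posz e2)
    = 36 * (2 * Posz e1) + 12 * (2 * Posz e2) by ring.
  by rewrite e1E e2E; lia.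
lia.
Qed.

End Representations.

(** * The norms of prime ideals *)

Section PrimeNorms.

Local Open Scope ring_scope.

Lemma dvdz_primeM (p : nat) (a b : int) : prime p ->
  (Posz p %| a * b)%Z = (Posz p %| a)%Z || (Posz p %| b)%Z.
Proof. by move=> pp; rewrite !dvdzE abszM /= Euclid_dvdM. Qed.

Lemma prime_not_square (p r : nat) : prime p -> (r * r)%N <> p.
Proof.
move=> pp rE; have p1 := prime_gt1 pp.
have rp : (r %| p)%N by rewrite -rE dvdn_mulr.
by have /orP[/eqP H|/eqP H] := (primeP pp).2 r rp; clear -rE p1 H; nia.
Qed.

(** Pigeonhole: if r^2 < p < (r + 1)^2, the pairs (i, j) with entries at most r outnumber the
    residues of i b - j a; x and y are the differences in a collision. *)
Lemma thue (p : nat) (a b : int) : prime p ->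
  exists x y : int,
    [/\ (x != 0) || (y != 0), x ^+ 2 < Posz p, y ^+ 2 < Posz p
      & (Posz p %| x * b - y * a)%Z].
Proof.
move=> pp.
have [r /andP[rp pr]] : exists r, (r * r <= p < r.+1 * r.+1)%N.
  elim: (p) => [|q [r /andP[rq qr]]]; first by exists 0%N.
  by have [e|ne] := eqVneq (q.+1)%N (r.+1 * r.+1)%N; [exists r.+1|exists r]; lia.
have {}rp : (r * r < p)%N.
  by rewrite ltn_neqAle rp andbT; apply/eqP/prime_not_square.
have p0 : Posz p != 0 by case: p pp {rp pr}.
have ltp (c : int) : (`|(c %% Posz p)%Z| < p)%N.
  by have := modz_ge0 c p0; have := ltz_mod c p0; lia.
pose f (v : 'I_r.+1 * 'I_r.+1) : 'I_p :=
  Ordinal (ltp (Posz v.1 * b - Posz v.2 * a)).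
have /injectivePn[[i j] [[i' j'] nij fij]] : ~~ injectiveb f.
  apply/injectiveP => /leq_card; rewrite card_prod !card_ord; lia.
exists (Posz i - Posz i'), (Posz j - Posz j').
have := ltn_ord i; have := ltn_ord i'; have := ltn_ord j; have := ltn_ord j'.
move=> lj' lj li' li; split; [|nia|nia|].
  move: nij; rewrite -negb_and; apply: contra => /andP[/eqP E1 /eqP E2].
  by rewrite xpair_eqE; apply/andP; split; apply/eqP/val_inj => /=; lia.
move: fij => /(congr1 val) /= E.
have {}E : ((Posz i * b - Posz j * a) = (Posz i' * b - Posz j' * a) %[mod Posz p])%Z.
  by have := modz_ge0 (Posz i * b - Posz j * a) p0;
    have := modz_ge0 (Posz i' * b - Posz j' * a) p0; lia.
rewrite (_ : _ - _ = (Posz i * b - Posz j * a) - (Posz i' * b - Posz j' * a));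
  last by ring.
by rewrite -eqz_mod_dvd; apply/eqP.
Qed.

(** Modulo p, -6 is the square of 3 z / (2 k). The previous lemma then yields x^2 + 6 y^2 = m p with
    1 <= m <= 6, and dividing out m leads to one of the two classes of forms of discriminant -24. *)
Lemma prime_norm6 (p : nat) (k z : int) : prime p -> (5 <= p)%N ->
  (Posz p %| 8 * k ^+ 2 + 3 * z ^+ 2)%Z ->
  ~~ ((Posz p %| k)%Z && (Posz p %| z)%Z) ->
  exists x y : int, x ^+ 2 + 6 * y ^+ 2 = Posz p \/ 2 * x ^+ 2 + 3 * y ^+ 2 = Posz p.
Proof.
move=> pp p5 pN pkz.
have p_small (c : nat) : (0 < c < 5)%N -> (Posz p %| Posz c)%Z = false.
  by move=> c5; rewrite dvdzE /= gtnNdvd //; lia.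
have pk : ~~ (Posz p %| k)%Z.
  apply: contra pkz => pk; rewrite pk /=.
  have : (Posz p %| 3 * z ^+ 2)%Z.
    by move: pN; rewrite rpredDl // expr2 !dvdz_mull.
  by rewrite dvdz_primeM // (p_small 3%N) //= expr2 dvdz_primeM // orbb.
have [x [y [xy0 xp yp pxy]]] := @thue p (3 * z) (2 * k) pp.
have : (Posz p %| (2 * k) ^+ 2 * (x ^+ 2 + 6 * y ^+ 2))%Z.
  have -> : (2 * k) ^+ 2 * (x ^+ 2 + 6 * y ^+ 2)
     = (x * (2 * k) - y * (3 * z)) * (x * (2 * k) + y * (3 * z))
       + 3 * y ^+ 2 * (8 * k ^+ 2 + 3 * z ^+ 2) by ring.
  by apply: rpredD; [apply: dvdz_mulr | apply: dvdz_mull].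
rewrite dvdz_primeM // expr2 !dvdz_primeM // (p_small 2%N) // (negPf pk) /=.
case/dvdzP => m mE.
have [m1 m6] : 1 <= m /\ m <= 6.
  have x0 := sqr_ge0 x; have y0 := sqr_ge0 y.
  have : x ^+ 2 != 0 \/ y ^+ 2 != 0 by rewrite !sqrf_eq0; apply/orP.
  move: mE xp yp x0 y0; clear; move: (x ^+ 2) (y ^+ 2) => X Y mE Xp Yp X0 Y0 XY.
  by split; nia.
clear pxy pN pk xp yp xy0.
have {m1 m6} : m = 1 \/ m = 2 \/ m = 3 \/ m = 4 \/ m = 5 \/ m = 6 by lia.
have sqr2 (c : int) : (2 %| c ^+ 2)%Z -> exists d, c = 2 * d.
  by rewrite (@dvdz_primeM 2) // orbb => /dvdzP[d ->]; exists d; rewrite mulrC.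
have sqr3 (c : int) : (3 %| c ^+ 2)%Z -> exists d, c = 3 * d.
  by rewrite (@dvdz_primeM 3) // orbb => /dvdzP[d ->]; exists d; rewrite mulrC.
case=> [m1|[m2|[m3|[m4|[m5|m6]]]]]; rewrite ?m1 ?m2 ?m3 ?m4 ?m5 ?m6 in mE.
- by exists x, y; left; lia.
- have [c cE] : exists c, x = 2 * c by apply: sqr2; lia.
  by exists c, y; right; apply: (@mulfI _ 2) => //; rewrite -mE cE; ring.
- have [c cE] : exists c, x = 3 * c by apply: sqr3; lia.
  by exists y, c; right; apply: (@mulfI _ 3) => //; rewrite -mE cE; ring.
- have [c cE] : exists c, x = 2 * c by apply: sqr2; lia.
  have [d dE] : exists d, y = 2 * d by apply: sqr2; rewrite cE in mE; lia.
  by exists c, d; left; apply: (@mulfI _ 4) => //; rewrite -mE cE dE; ring.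
(* For m = 5, x = 5 b + 2 y gives p = 2 (b + y)^2 + 3 b^2, and similarly with -y. *)
- have : (5 %| (x - 2 * y) * (x + 2 * y))%Z.
    have -> : (x - 2 * y) * (x + 2 * y) = 5 * (Posz p - 2 * y ^+ 2).
      by rewrite mulrBr [5 * Posz p]mulrC in mE *; lia.
    by rewrite dvdz_mulr.
  rewrite (@dvdz_primeM 5) // => /orP[] /dvdzP[b bE].
    exists (b + y), b; right; apply: (@mulfI _ 5) => //.
    have xE : x = b * 5 + 2 * y by rewrite -bE subrK.
    by rewrite -mE xE; ring.
  exists (b - y), b; right; apply: (@mulfI _ 5) => //.
  have xE : x = b * 5 - 2 * y by rewrite -bE addrK.
  by rewrite -mE xE; ring.
have [c cE] : exists c, x = 2 * c by apply: sqr2; lia.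
have [d dE] : exists d, c = 3 * d by apply: sqr3; rewrite cE in mE; lia.
by exists y, d; left; apply: (@mulfI _ 6) => //; rewrite -mE cE dE; ring.
Qed.

(** The forms are squared: (x^2 - 6 y^2)^2 + 24 (x y)^2 = (x^2 + 6 y^2)^2, and likewise for 2 x^2 +
    3 y^2. As u^2 = p^2 = 1 modulo 3, a choice of sign gives u = 1 modulo 3. *)
Lemma split_or_inert (p : nat) : prime p -> (5 <= p)%N ->
  (exists u v : int,
     [/\ u ^+ 2 + 24 * v ^+ 2 = Posz p ^+ 2, v != 0 & (3 %| u - 1)%Z])
  \/ (forall k z : int, (Posz p %| 8 * k ^+ 2 + 3 * z ^+ 2)%Z ->
        (Posz p %| k)%Z && (Posz p %| z)%Z).
Proof.
move=> pp p5.
have p_odd : (2 %| Posz p)%Z = false by rewrite dvdzE /= dvdn_prime2 //; lia.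
have p_not3 : (3 %| Posz p)%Z = false by rewrite dvdzE /= dvdn_prime2 //; lia.
have [inert|/not_all_ex_not[k /not_all_ex_not[z kz]]] := classic
  (forall k z : int, (Posz p %| 8 * k ^+ 2 + 3 * z ^+ 2)%Z ->
        (Posz p %| k)%Z && (Posz p %| z)%Z); first by right.
left; have [pN /negP pkz] := imply_to_and _ _ kz.
have [x [y xyE]] := prime_norm6 pp p5 pN pkz.
have [a [b [abE b0]]] : exists a b, a ^+ 2 + 24 * b ^+ 2 = Posz p ^+ 2 /\ b != 0.
  (* Otherwise p would be a square or a multiple of 2 or 3. *)
  have xy0 : x * y != 0.
    rewrite mulf_eq0; apply/norP; split; apply/eqP => E.
      case: xyE; rewrite E expr0n /= ?mulr0 add0r => pE.
        by move: p_odd; rewrite -pE (_ : 6 = 2 * 3) // -mulrA dvdz_mulr.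
      by move: p_not3; rewrite -pE dvdz_mulr.
    case: xyE; rewrite E expr0n /= mulr0 addr0 => pE; last first.
      by move: p_odd; rewrite -pE dvdz_mulr.
    have {}pE : (`|x| * `|x|)%N = p by rewrite -abszM -expr2 pE.
    exact: prime_not_square pp pE.
  by case: xyE => <-; [exists (x ^+ 2 - 6 * y ^+ 2), (x * y)
    | exists (2 * x ^+ 2 - 3 * y ^+ 2), (x * y)]; split=> //; ring.
have a3 : (3 %| (a - 1) * (- a - 1))%Z.
  have -> : (a - 1) * (- a - 1) = 3 * (8 * b ^+ 2) - (Posz p - 1) * (Posz p + 1).
    have -> : (Posz p - 1) * (Posz p + 1) = a ^+ 2 + 24 * b ^+ 2 - 1.
      by rewrite abE; ring.
    ring.
  apply: rpredB; first exact: dvdz_mulr.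
  by rewrite (@dvdz_primeM 3) //; clear -p_not3; lia.
case: (boolP (3 %| a - 1)%Z) => [a31|a31]; first by exists a, b.
exists (- a), b; rewrite sqrrN; split=> //.
by move: a3; rewrite (@dvdz_primeM 3) // (negPf a31).
Qed.

End PrimeNorms.

(** * The Hecke recursion *)

Section Hecke.

Local Open Scope ring_scope.

Implicit Types (s u v : int) (w : int * int) (N p : nat).

Definition dvd_pair p w : bool := (Posz p %| w.1)%Z && (Posz p %| w.2)%Z.

(** With this sign, scaling a solution by [pi] preserves its classes modulo 3. *)
Lemma signed_prime p : prime p -> (5 <= p)%N ->
  exists2 pi : int, pi = Posz p \/ pi = - Posz p & (3 %| pi - 1)%Z.
Proof.
move=> pp p5.
have p_not3 : (3 %| Posz p)%Z = false by rewrite dvdzE /= dvdn_prime2 //; lia.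
case: (boolP (3 %| Posz p - 1)%Z) => p3; first by exists (Posz p); auto.
by exists (- Posz p); auto; lia.
Qed.

Lemma count_scaled p (pi : int) s N (Q : pred (int * int)) : (0 < p)%N ->
  pi = Posz p \/ pi = - Posz p -> (3 %| pi - 1)%Z ->
  count (fun w => [&& is_rep s (p ^ 2 * N) w, dvd_pair p w & Q w])
    (int_box (p ^ 2 * N))
  = count (fun w => is_rep s N w && Q (pi * w.1, pi * w.2)) (int_box N).
Proof.
move=> p0 piE pi3.
have pi0 : pi != 0 by lia.
have pi2 : Posz (p ^ 2 * N) = pi ^+ 2 * Posz N.
  by rewrite PoszM -mulnn PoszM; case: piE => ->; ring.
have dvdpi c : (Posz p %| c)%Z = (pi %| c)%Z by case: piE => ->; rewrite !dvdzE ?abszN.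
have mod3 c e : (3 %| pi * c + e)%Z = (3 %| c + e)%Z.
  case/dvdzP: pi3 => q /eqP; rewrite subr_eq => /eqP ->; clear.
  by rewrite mulrDl mul1r -mulrA [3 * _]mulrC mulrA; lia.
have repE c d : is_rep s (p ^ 2 * N) (pi * c, pi * d) = is_rep s N (c, d).
  rewrite /is_rep /= pi2 !mod3; congr (_ && _).
  have -> : 8 * (pi * c) ^+ 2 + 3 * (pi * d) ^+ 2
    = pi ^+ 2 * (8 * c ^+ 2 + 3 * d ^+ 2) by ring.
  by rewrite (inj_eq (mulfI _)) // expf_neq0.
apply: (@count_bij _ _ _ _ _ _ (fun w => ((w.1 %/ pi)%Z, (w.2 %/ pi)%Z))
  (fun w => (pi * w.1, pi * w.2))); rewrite ?uniq_int_box //.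
  move=> [c d] _ /and3P[/= R /andP[/=]]; rewrite !dvdpi.
  move=> /dvdzP[c' cE] /dvdzP[d' dE]; move: R.
  rewrite cE dE !mulzK // ![_ * pi]mulrC repE => R QR.
  by split=> //; rewrite ?R //; apply: is_rep_box R.
move=> [c d] _ /andP[/= R QR]; rewrite !mulKz // QR andbT repE R.
by rewrite /dvd_pair /= !dvdpi !dvdz_mulr // (@is_rep_box s) // repE.
Qed.

Lemma count_divisible_reps p s N : prime p -> (5 <= p)%N ->
  count (fun w => is_rep s N w && dvd_pair p w) (int_box N)
  = if (p ^ 2 %| N)%N then num_reps s (N %/ p ^ 2) else 0%N.
Proof.
move=> pp p5; have p0 := prime_gt0 pp; have [pi piE pi3] := signed_prime pp p5.
case: ifP => [/dvdnP[M ->]|pN].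
  rewrite mulnC mulKn ?expn_gt0 ?p0 //.
  have := @count_scaled p pi s M xpredT p0 piE pi3.
  under eq_count do rewrite andbT; move=> ->.
  by under eq_count do rewrite andbT.
apply/eqP; rewrite -leqn0 leqNgt -has_count; apply/hasPn => -[c d] _ /=.
apply: contraFN pN => /andP[/and3P[/eqP /= E _ _]].
case/andP => /= /dvdzP[c' cE] /dvdzP[d' dE].
have : (Posz p ^+ 2 %| Posz N)%Z.
  rewrite -E cE dE; apply/dvdzP; exists (8 * c' ^+ 2 + 3 * d' ^+ 2); ring.
by rewrite dvdzE abszX.
Qed.

(* A solution at level [p ^ 2 * N] lies in the image of multiplication by
   [u + v sqrt (-24)], of norm [p ^ 2]. *)
Definition in_lattice p u v w : bool :=
  (Posz p ^+ 2 %| u * w.1 - 3 * v * w.2)%Z.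

Section Split.

Variables (p : nat) (u v : int).
Hypotheses (pp : prime p) (p5 : (5 <= p)%N).
Hypotheses (uvE : u ^+ 2 + 24 * v ^+ 2 = Posz p ^+ 2) (v0 : v != 0).

(** A nonzero multiple v of p would give 24 v^2 > p^2; and p | u would force p | 24 v^2. *)
Lemma split_coprime : (Posz p %| u)%Z = false /\ (Posz p %| v)%Z = false.
Proof.
have small (c : nat) : (0 < c < 5)%N -> (Posz p %| Posz c)%Z = false.
  by move=> c5; rewrite dvdzE /= gtnNdvd //; clear -c5 p5; lia.
have pv : (Posz p %| v)%Z = false.
  apply/negP => /dvdzP[q vE].
  have q0 : q != 0 by apply: contraNneq v0 => q0; rewrite vE q0 mul0r.
  have p0 : 0 < Posz p ^+ 2 by rewrite exprn_gt0 // ltz_nat prime_gt0.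
  have q1 : 1 <= q ^+ 2.
    have := sqr_ge0 q; have : q ^+ 2 != 0 by rewrite sqrf_eq0.
    by move: (q ^+ 2); clear; lia.
  have u0 := sqr_ge0 u; move: uvE; rewrite vE exprMn.
  move: p0 q1 u0; clear; move: (_ ^+ 2) (q ^+ 2) (u ^+ 2) => A B C; nia.
split=> //; apply/negP => pu; move: pv.
have : (Posz p %| 24 * v ^+ 2)%Z.
  have -> : 24 * v ^+ 2 = Posz p * Posz p - u * u.
    by rewrite -(expr2 (Posz p)) -uvE; ring.
  by apply: rpredB; apply: dvdz_mulr.
have -> : 24 * v ^+ 2 = 2 * 2 * 2 * 3 * (v * v) by ring.
by rewrite !dvdz_primeM // (small 2%N) // (small 3%N) //= orbb => ->.
Qed.

(** Multiplying 3 z + k sqrt(-24) by u + v sqrt(-24) scales 8 k^2 + 3 z^2 by p^2 and, as u = 1 and k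
    = -1 modulo 3, sends z to z - v modulo 3. The conjugate divided by p^2 is the inverse. *)
Lemma count_in_lattice s N : (3 %| u - 1)%Z ->
  count (fun w => is_rep s (p ^ 2 * N) w && in_lattice p u v w)
    (int_box (p ^ 2 * N))
  = num_reps (s + v) N.
Proof.
move=> u3; have [pu _] := split_coprime.
have p0 : Posz p ^+ 2 != 0 by rewrite expf_neq0 //; clear -p5; lia.
have pN : Posz (p ^ 2 * N) = Posz p ^+ 2 * Posz N.
  by rewrite PoszM -mulnn PoszM expr2.
have ppu : coprimez (Posz p ^+ 2) u.
  rewrite coprimez_pexpl // coprimezE /= prime_coprime //.
  by rewrite -[(_ %| _)%N]/(Posz p %| u)%Z pu.
pose g w : int * int := (u * w.1 + 3 * v * w.2, u * w.2 - 8 * v * w.1).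
have repE w : is_rep s (p ^ 2 * N) (g w) = is_rep (s + v) N w.
  case: w => k z; rewrite /is_rep /= pN.
  have -> : 8 * (u * k + 3 * v * z) ^+ 2 + 3 * (u * z - 8 * v * k) ^+ 2
    = (u ^+ 2 + 24 * v ^+ 2) * (8 * k ^+ 2 + 3 * z ^+ 2) by ring.
  rewrite uvE (inj_eq (mulfI p0)); congr (_ && _).
  have [q uE] : exists q, u = 3 * q + 1.
    by case/dvdzP: u3 => q uE; exists q; rewrite mulrC -uE subrK.
  have -> : u * k + 3 * v * z + 1 = 3 * (q * k + v * z) + (k + 1) by rewrite uE; ring.
  have [k3|k3] := boolP (3 %| k + 1)%Z; last first.
    by rewrite rpredDl ?dvdz_mulr // (negPf k3).
  rewrite rpredD ?dvdz_mulr //=.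
  have -> : u * z - 8 * v * k - s
    = 3 * (q * z - 3 * v * k) + (v * (k + 1) + (z - (s + v))) by rewrite uE; ring.
  by rewrite rpredDl ?dvdz_mulr // rpredDl // dvdz_mull.
apply: (@count_bij _ _ _ _ _ _
  (fun w => (((u * w.1 - 3 * v * w.2) %/ Posz p ^+ 2)%Z,
             ((u * w.2 + 8 * v * w.1) %/ Posz p ^+ 2)%Z)) g);
  rewrite ?uniq_int_box //.
  move=> [k z] _ /andP[R /dvdzP[k' /= k'E]].
  (* The lattice condition on the first coordinate carries over to the second, because u is prime to
     p. *)
  have : (Posz p ^+ 2 %| u * (u * z + 8 * v * k))%Z.
    have -> : u * (u * z + 8 * v * k)
      = Posz p ^+ 2 * z + 8 * v * (u * k - 3 * v * z) by rewrite -uvE; ring.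
    by rewrite k'E; apply: rpredD; [apply: dvdz_mulr | rewrite mulrA; apply: dvdz_mull].
  rewrite Gauss_dvdzr // => /dvdzP[z' z'E].
  rewrite k'E z'E !mulzK //.
  have gE : g (k', z') = (k, z).
    congr (_, _); apply: (mulIf p0) => /=.
      rewrite mulrDl -!mulrA -k'E -z'E -uvE; ring.
    rewrite mulrBl -!mulrA -k'E -z'E -uvE; ring.
  have R' : is_rep (s + v) N (k', z') by rewrite -repE gE.
  by split=> //; apply: is_rep_box R'.
move=> [k z] _ R; rewrite repE R; split.
- by apply: (@is_rep_box s); rewrite repE.
- rewrite /in_lattice /=; apply/dvdzP; exists k; rewrite -uvE; ring.
rewrite /=.
have -> : u * (u * k + 3 * v * z) - 3 * v * (u * z - 8 * v * k) = k * Posz p ^+ 2.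
  by rewrite -uvE; ring.
have -> : u * (u * z - 8 * v * k) + 8 * v * (u * k + 3 * v * z) = z * Posz p ^+ 2.
  by rewrite -uvE; ring.
by rewrite !mulzK.
Qed.

End Split.

Section SplitRecursion.

Variables (p : nat) (u v : int).
Hypotheses (pp : prime p) (p5 : (5 <= p)%N).
Hypotheses (uvE : u ^+ 2 + 24 * v ^+ 2 = Posz p ^+ 2) (v0 : v != 0).

Let p_coprime := split_coprime pp p5 uvE v0.

Let p_small (c : nat) : (0 < c < 5)%N -> (Posz p %| Posz c)%Z = false.
Proof. by move=> c5; rewrite dvdzE /= gtnNdvd //; lia. Qed.

Let lat (k z : int) : int := u * k - 3 * v * z.
Let lat' (k z : int) : int := u * k - 3 * (- v) * z.

Lemma lattice_mulE k z :
  lat k z * lat' k z = Posz p ^+ 2 * k ^+ 2 - 3 * v ^+ 2 * (8 * k ^+ 2 + 3 * z ^+ 2).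
Proof. by rewrite -uvE /lat /lat'; ring. Qed.

Lemma dvd_lattices k z :
  (Posz p %| lat k z)%Z && (Posz p %| lat' k z)%Z = dvd_pair p (k, z).
Proof.
have [pu pv] := p_coprime.
apply/andP/andP => /= [[h h']|[pk pz]].
  have : (Posz p %| 2 * u * k)%Z.
    have -> : 2 * u * k = lat k z + lat' k z by rewrite /lat /lat'; ring.
    exact: rpredD.
  have : (Posz p %| 2 * 3 * v * z)%Z.
    have -> : 2 * 3 * v * z = lat' k z - lat k z by rewrite /lat /lat'; ring.
    exact: rpredB.
  by rewrite !dvdz_primeM // (@p_small 2%N) // (@p_small 3%N) // pu pv.
by split; apply: rpredB; apply: dvdz_mull.
Qed.

(** The two conjugate lattices count the solutions for p^2 N. Those divisible by p may be counted
    zero, one or two times, whence the correction terms, arranged to avoid subtraction. *)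
Lemma split_recursion s N : (3 %| u - 1)%Z ->
  (num_reps s (p ^ 2 * N) + (p %| N) * num_reps s N
     + count (fun w => is_rep s N w && dvd_pair p w) (int_box N)
   = num_reps s N + num_reps (s + v) N + num_reps (s - v) N)%N.
Proof.
move=> u3; have [pu pv] := p_coprime; have p0 := prime_gt0 pp.
have [pi piE pi3] := signed_prime pp p5.
have scaled := @count_scaled p pi s N _ p0 piE pi3.
have sE := scaled xpredT; have s1 := scaled (in_lattice p u v).
have s2 := scaled (in_lattice p u (- v)).
have l1 := @count_in_lattice p u v pp p5 uvE v0 s N u3.
have l2 := @count_in_lattice p u (- v) pp p5.
rewrite sqrrN oppr_eq0 in l2; have {}l2 := l2 uvE v0 s N u3.
set X := is_rep s (p ^ 2 * N) in sE s1 s2 l1 l2 *.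
set B := int_box (p ^ 2 * N) in sE s1 s2 l1 l2 *.
have reps : num_reps s (p ^ 2 * N) =
  (count (fun w => X w && ~~ dvd_pair p w) B + num_reps s N)%N.
  rewrite /num_reps -/X -/B.
  have -> : count (is_rep s N) (int_box N) =
    count (fun w => [&& X w, dvd_pair p w & true]) B.
    by rewrite sE; apply: eq_count => w; rewrite andbT.
  elim: (B) => //= w r ->; case: (X w) => //=; case: (dvd_pair p w) => /=; clear; lia.
(* A solution not divisible by p lies in exactly one lattice: p^2 divides the product of the two
   forms, and p does not divide both. *)
have big : (count (fun w => X w && ~~ dvd_pair p w) B
    + count (fun w => [&& X w, dvd_pair p w & in_lattice p u v w]) B
    + count (fun w => [&& X w, dvd_pair p w & in_lattice p u (- v) w]) B
    = num_reps (s + v) N + num_reps (s - v) N)%N.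
  rewrite -l1 -l2.
  have pt w : ((X w && ~~ dvd_pair p w) + [&& X w, dvd_pair p w & in_lattice p u v w]
     + [&& X w, dvd_pair p w & in_lattice p u (- v) w]
     = (X w && in_lattice p u v w) + (X w && in_lattice p u (- v) w))%N.
    have [Xw|//] := boolP (X w); have [//|Dw] /= := boolP (dvd_pair p w).
    case: w Xw Dw => k z /and3P[/eqP /= N' _ _]; rewrite -dvd_lattices.
    have : (Posz p ^+ 2 %| lat k z * lat' k z)%Z.
      rewrite lattice_mulE N' PoszM -mulnn PoszM -expr2.
      by apply: rpredB; [apply: dvdz_mulr | apply/dvdz_mull/dvdz_mulr].
    rewrite /in_lattice /= -/(lat k z) -/(lat' k z).
    have dvd2 c : (Posz p %| c)%Z = false -> (Posz p ^+ 2 %| c)%Z = false.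
      by move=> pc; apply: contraFF pc; apply: dvdz_trans; rewrite expr2 dvdz_mulr.
    have cop c : (Posz p %| c)%Z = false -> coprimez (Posz p ^+ 2) c.
      move=> pc; rewrite coprimez_pexpl // coprimezE /= prime_coprime //.
      by rewrite -[(_ %| _)%N]/(Posz p %| c)%Z pc.
    move=> H; rewrite negb_and => /orP[] /negPf pc; move: H.
      by rewrite Gauss_dvdzr ?cop // (dvd2 _ pc) => ->.
    by rewrite Gauss_dvdzl ?cop // (dvd2 _ pc) => ->.
  elim: (B) => //= w r; have := pt w.
  move: (X w && ~~ _) (X w && in_lattice p u v w) (X w && in_lattice p u (- v) w).
  move: [&& _, _ & _] [&& _, _ & _] => b1 b2 b3 b4 b5; clear; lia.
(* A solution scaled by [pi] lies in a lattice when p divides the form at the original one. The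
   product of the forms is -3 v^2 N modulo p, so this happens for some lattice exactly when p | N,
   and for both when p divides the solution. *)
have little : (count (fun w => [&& X w, dvd_pair p w & in_lattice p u v w]) B
    + count (fun w => [&& X w, dvd_pair p w & in_lattice p u (- v) w]) B
   = (p %| N) * num_reps s N
     + count (fun w => is_rep s N w && dvd_pair p w) (int_box N))%N.
  rewrite s1 s2 /num_reps.
  have pt w : ((is_rep s N w && in_lattice p u v ((pi * w.1)%R, (pi * w.2)%R))
      + (is_rep s N w && in_lattice p u (- v) ((pi * w.1)%R, (pi * w.2)%R))
    = (p %| N) * is_rep s N w + (is_rep s N w && dvd_pair p w))%N.
    have [Rw|_] := boolP (is_rep s N w); last by rewrite muln0.
    case: w Rw => k z /and3P[/eqP /= N' _ _]; rewrite -dvd_lattices muln1.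
    have lE x : in_lattice p u x (pi * k, pi * z) = (Posz p %| u * k - 3 * x * z)%Z.
      rewrite /in_lattice /=.
      have -> : u * (pi * k) - 3 * x * (pi * z) = pi * (u * k - 3 * x * z) by ring.
      rewrite expr2; have p1 : Posz p != 0 by clear -p0; lia.
      by case: piE => ->; rewrite ?mulNr ?rpredN; rewrite dvdz_mul2l.
    have pN : (Posz p %| lat k z)%Z || (Posz p %| lat' k z)%Z = (p %| N)%N.
      rewrite -dvdz_primeM // lattice_mulE N' rpredBl; last first.
        by rewrite expr2 -mulrA dvdz_mulr.
      by rewrite expr2 !dvdz_primeM // (@p_small 3%N) // pv.
    rewrite !lE -/(lat k z) -/(lat' k z) -pN.
    by case: (_ %| lat k z)%Z; case: (_ %| lat' k z)%Z.
  elim: (int_box N) => /= [|w r IHr]; first by rewrite muln0.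
  rewrite mulnDr addnACA pt IHr addnACA; congr (_ + _)%N; exact: addnC.
by rewrite reps; move: big little; clear; lia.
Qed.

End SplitRecursion.

End Hecke.

(** * The recursion modulo 2 *)

Section HeckeParity.

Local Open Scope ring_scope.

Lemma num_reps_mod3 (s t : int) N : (3 %| s - t)%Z -> num_reps s N = num_reps t N.
Proof.
move=> st; apply: eq_count => w; congr [&& _, _ & _].
have -> : w.2 - s = w.2 - t - (s - t) by ring.
by rewrite rpredBr.
Qed.

Lemma num_repsN (s : int) N : num_reps (- s) N = num_reps s N.
Proof.
have repN t k z : is_rep t N (k, - z) = is_rep (- t) N (k, z).
  rewrite /is_rep /= sqrrN; congr [&& _, _ & _].
  by rewrite -rpredN; congr (_ %| _)%Z; ring.
apply: (@count_bij _ _ _ _ _ _ (fun w => (w.1, - w.2)) (fun w => (w.1, - w.2)));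
  rewrite ?uniq_int_box // => -[k z] _ R.
  have R' : is_rep s N (k, - z) by rewrite repN.
  by rewrite /= opprK; split=> //; apply: is_rep_box R'.
have R' : is_rep (- s) N (k, - z) by rewrite repN opprK.
by rewrite /= opprK; split=> //; apply: is_rep_box R'.
Qed.

(** The involution z -> -z could only fix z = 0, where N = 8 k^2 is even. *)
Lemma num_reps0_even N : odd N -> odd (num_reps 0 N) = false.
Proof.
move=> oN; rewrite /num_reps.
rewrite (@odd_count_involution _ _ _ (fun w => (w.1, - w.2))) ?uniq_int_box //.
  rewrite (@eq_count _ _ pred0) ?count_pred0 // => -[k z] /=.
  apply/negP => /andP[/and3P[/eqP /= N' _ _] /eqP[z0]].
  have {}z0 : z = 0 by clear -z0; lia.
  move: N'; rewrite z0 expr0n mulr0 addr0; move: (k ^+ 2) => X; clear -oN; lia.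
move=> [k z]; rewrite !mem_int_box abszN /= => kz R; rewrite opprK; split=> //.
by move: R; rewrite /is_rep /= !subr0 sqrrN rpredN.
Qed.

Definition rep_parity N := odd (num_reps (-1) N).

(** In the split case, if 3 | v the two shifted counts are equal and cancel; otherwise the shifted
    classes are 0, with an even count, and 1, which z -> -z exchanges with -1. *)
Lemma hecke_parity (p : nat) : prime p -> (5 <= p)%N ->
  exists lam : bool, forall N, odd N ->
    rep_parity (p ^ 2 * N)
    = ((~~ (p %| N)%N (+) lam) && rep_parity N)
      (+) ((p ^ 2 %| N)%N && rep_parity (N %/ p ^ 2)).
Proof.
move=> pp p5; have p0 := prime_gt0 pp.
have divE N : odd (count (fun w => is_rep (-1) N w && dvd_pair p w) (int_box N))
    = (p ^ 2 %| N)%N && rep_parity (N %/ p ^ 2).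
  by rewrite count_divisible_reps //; case: ifP.
have [[u [v [uvE v0 u3]]]|inert] := split_or_inert pp p5; last first.
  exists false => N _; have [pi piE pi3] := signed_prime pp p5.
  have E : num_reps (-1) (p ^ 2 * N) = num_reps (-1) N.
    have := @count_scaled p pi (-1) N xpredT p0 piE pi3.
    under [in RHS]eq_count do rewrite andbT.
    rewrite /num_reps => <-; apply: eq_count => -[k z].
    rewrite andbT; apply/idP/andP => [R|[]//]; split=> //.
    case/and3P: R => /eqP /= N' _ _; apply: inert.
    by rewrite N' -mulnn -mulnA dvdzE dvdn_mulr.
  rewrite {1}/rep_parity E -/(rep_parity N) addbF.
  (* For p inert and p | N, all solutions are divisible by p, so the parities at N and N / p^2
     agree, the latter read as 0 unless p^2 | N. *)
  have [pN|pN] := boolP (p %| N)%N; last first.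
    have -> : (p ^ 2 %| N)%N = false; last by rewrite addbF.
    by apply: contraNF pN; apply: dvdn_trans; rewrite dvdn_exp.
  rewrite -divE /=; congr (odd _); apply: eq_count => -[k z] /=.
  have [/and3P[/eqP /= N' _ _]|//] := boolP (is_rep _ _ _).
  by rewrite /dvd_pair /= inert // N' dvdzE.
exists (~~ (3 %| v)%Z) => N oN.
have sum_v : odd (num_reps (-1 + v) N) (+) odd (num_reps (-1 - v) N)
    = ~~ (3 %| v)%Z && rep_parity N.
  have [/dvdzP[q vE]|v3] := boolP (3 %| v)%Z.
    rewrite (@num_reps_mod3 (-1 + v) (-1)) ?(@num_reps_mod3 (-1 - v) (-1)).
    - by rewrite addbb.
    - by clear -vE; lia.
    - by clear -vE; lia.
  have [v1|v1] := boolP (3 %| v - 1)%Z.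
    rewrite (@num_reps_mod3 (-1 + v) 0) ?(@num_reps_mod3 (-1 - v) 1).
    - by rewrite num_reps0_even //= -[1]opprK num_repsN.
    - by clear -v1; lia.
    - by clear -v1; lia.
  rewrite (@num_reps_mod3 (-1 + v) 1) ?(@num_reps_mod3 (-1 - v) 0).
  - by rewrite num_reps0_even // addbF -[1]opprK num_repsN.
  - by clear -v1 v3; lia.
  - by clear -v1 v3; lia.
have := split_recursion pp p5 uvE v0 (-1) N u3; move: sum_v; rewrite -divE /rep_parity.
move: (num_reps (-1 + v) N) (num_reps (-1 - v) N) (num_reps _ (p ^ 2 * N)).
move: (num_reps _ N) (count _ _) => a c d e f sum_v /(congr1 odd).
rewrite !oddD oddM oddb; move: (odd a) (odd c) (odd d) (odd e) (odd f) sum_v.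
by case: (p %| N)%N; case: (3 %| v)%Z; do 5!case.
Qed.

End HeckeParity.

(** * Parities along the powers of p *)

Section Powers.

Variables (p : nat) (lam : bool).
Hypotheses (pp : prime p) (p5 : 5 <= p).
Hypothesis hecke : forall N, odd N ->
    rep_parity (p ^ 2 * N)
    = ((~~ (p %| N) (+) lam) && rep_parity N)
      (+) ((p ^ 2 %| N) && rep_parity (N %/ p ^ 2)).

Lemma odd_prime_pow j m : odd m -> odd (p ^ j * m).
Proof.
by move=> om; rewrite oddM oddX om andbT; case: (even_prime pp) => [|->];
  [lia | rewrite orbT].
Qed.

Lemma rep_parity_pow2 m : odd m -> ~~ (p %| m) ->
  rep_parity (p ^ 2 * m) = ~~ lam && rep_parity m.
Proof.
move=> om pm; rewrite hecke // pm.
have -> : (p ^ 2 %| m) = false.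
  by apply: contraNF pm; apply: dvdn_trans; rewrite dvdn_exp.
by rewrite addbF addTb.
Qed.

Lemma rep_parity_pow3 m : odd m -> ~~ (p %| m) ->
  rep_parity (p ^ 3 * m) = lam && rep_parity (p * m).
Proof.
move=> om pm; have p0 := prime_gt0 pp.
rewrite (expnD p 2 1) -mulnA expn1 hecke; last first.
  by rewrite -{1}(expn1 p) odd_prime_pow.
by rewrite (dvdn_mulr m (dvdnn p)) -(mulnn p) dvdn_pmul2l // (negPf pm) addbF.
Qed.

Lemma rep_parity_pow4 j m : odd m ->
  rep_parity (p ^ (j + 4) * m)
  = (lam && rep_parity (p ^ (j + 2) * m)) (+) rep_parity (p ^ j * m).
Proof.
move=> om; have p0 := prime_gt0 pp.
have -> : p ^ (j + 4) * m = p ^ 2 * (p ^ (j + 2) * m).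
  by rewrite mulnA -expnD; congr (p ^ _ * m); lia.
rewrite hecke ?odd_prime_pow // [j + 2]addnC expnD -mulnA.
have -> : p %| p ^ 2 * (p ^ j * m) by rewrite dvdn_mulr // dvdn_exp.
by rewrite (dvdn_mulr _ (dvdnn _)) mulKn // expn_gt0 p0.
Qed.

End Powers.

(** * Translation to the arguments of b_21 *)

Lemma prime_pow_mod24 p j : prime p -> 5 <= p -> exists q, p ^ (2 * j) = 24 * q + 1.
Proof.
move=> pp p5; have p2 : (2 %| p) = false by rewrite dvdn_prime2 //; lia.
have p3 : (3 %| p) = false by rewrite dvdn_prime2 //; lia.
have p24 : (p ^ 2) %% 24 = 1.
  rewrite -modnXm; have : p %% 24 < 24 by rewrite ltn_mod.
  have : (2 %| p %% 24) = false by clear -p2; lia.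
  have : (3 %| p %% 24) = false by clear -p3; lia.
  by move: (p %% 24) => r; do 24![case: r => [|r] //].
have pj : p ^ (2 * j) %% 24 = 1 by rewrite expnM -modnXm p24 exp1n.
by exists (p ^ (2 * j) %/ 24); rewrite [LHS](divn_eq _ 24) pj mulnC.
Qed.

(* Since p is coprime to 6, p ^ (2 * j) = 1 %[mod 6], so 11 * p ^ (2 * j) >= 5
   and 6 divides 11 * p ^ (2 * j) - 5: every subtraction and division below is
   exact. *)
Theorem theorem1p2 (p : nat) (p_prime : prime p) (p_ge5 : 5 <= p)
    (p_neq11 : p <> 11) :
  (b21 ((11 * p ^ 2 - 5) %/ 6) = 1 %[mod 2] ->
     (forall n k beta : nat, 1 <= beta < p ->
        b21 (4 * p ^ (4 * k + 4) * n + 4 * p ^ (4 * k + 3) * beta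
             + (11 * p ^ (4 * k + 4) - 5) %/ 6) = 0 %[mod 2]) /\
     (forall k : nat, b21 ((11 * p ^ (4 * k) - 5) %/ 6) = 1 %[mod 2]))
  /\
  (b21 ((11 * p ^ 2 - 5) %/ 6) = 0 %[mod 2] ->
     (forall n k : nat, ~~ (p %| 24 * n + 11) ->
        b21 (4 * p ^ (6 * k + 2) * n
             + (11 * p ^ (6 * k + 2) - 5) %/ 6) = 0 %[mod 2]) /\
     (forall k : nat, b21 ((11 * p ^ (6 * k) - 5) %/ 6) = 1 %[mod 2])).
Proof.
have [lam hecke] := hecke_parity p_prime p_ge5.
have p_not11 : ~~ (p %| 11) by rewrite dvdn_prime2 //; apply/eqP.
have op : odd p by case: (even_prime p_prime) => //; lia.
have oddX24 n : odd (24 * n + 11) by rewrite oddD oddM.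
(* With p^(2 j) = 24 q + 1 the argument is 4 (p^(2 j) n + 11 q) + 1, and 24 (p^(2 j) n + 11 q) + 11
   = p^(2 j) (24 n + 11). *)
have b21E j n : b21 (4 * p ^ (2 * j) * n + (11 * p ^ (2 * j) - 5) %/ 6)
    = rep_parity (p ^ (2 * j) * (24 * n + 11)) %[mod 2].
  have [q qE] := prime_pow_mod24 j p_prime p_ge5.
  have -> : 4 * p ^ (2 * j) * n + (11 * p ^ (2 * j) - 5) %/ 6
    = 4 * (p ^ (2 * j) * n + 11 * q) + 1 by rewrite {}qE; nia.
  rewrite !modn2 oddb odd_b21 -/(rep_parity _); congr (nat_of_bool (rep_parity _)).
  by rewrite qE; nia.
have b21E0 j : b21 ((11 * p ^ (2 * j) - 5) %/ 6)
    = rep_parity (p ^ (2 * j) * 11) %[mod 2].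
  by have := b21E j 0; rewrite !muln0 !add0n.
have rep_parity11 : rep_parity 11 by vm_compute.
have rec2 := rep_parity_pow2 hecke; have rec3 := rep_parity_pow3 p_prime p_ge5 hecke.
have rec4 := rep_parity_pow4 p_prime p_ge5 hecke.
(* As p is prime to 11, the hypotheses of (i) and (ii) say that [lam] is false and true
   respectively. *)
have lamE : rep_parity (p ^ 2 * 11) = ~~ lam by rewrite rec2 // rep_parity11 andbT.
have := b21E0 1; rewrite muln1 lamE => ->.
rewrite !modn2; case: (lam) rec2 rec3 rec4 => rec2 rec3 rec4;
  first (split=> [//|_]; split); last (split=> [_|//]; split).
- move=> n k pn; rewrite -!modn2 (_ : 6 * k + 2 = 2 * (3 * k + 1)); last by lia.
  rewrite b21E; suff -> : rep_parity (p ^ (2 * (3 * k + 1)) * (24 * n + 11)) = false by [].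
  (* For a_j the parity at p^(2 j) times a fixed number, a_(j+2) = a_(j+1) + a_j; used twice, this
     gives a_(j+3) = a_j. *)
  elim: k => [|k IHk]; first by rewrite rec2.
  rewrite (_ : 2 * (3 * k.+1 + 1) = 2 * (3 * k + 1) + 2 + 4); last by lia.
  rewrite rec4 // -addnA rec4 // IHk.
  by case: (rep_parity _).
- move=> k; rewrite -!modn2 (_ : 6 * k = 2 * (3 * k)); last by lia.
  rewrite b21E0; suff -> : rep_parity (p ^ (2 * (3 * k)) * 11) by [].
  elim: k => [|k IHk]; first by rewrite mul1n.
  rewrite (_ : 2 * (3 * k.+1) = 2 * (3 * k) + 2 + 4); last by lia.
  rewrite rec4 // -addnA rec4 // IHk.
  by case: (rep_parity _).
- move=> n k beta /andP[beta0 beta_p]; rewrite -!modn2.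
  (* The argument will correspond to p^(4 k + 3) times this number, which is prime to p because 24
     beta is. *)
  have pm : ~~ (p %| 24 * (p * n + beta) + 11 * p).
    have -> : 24 * (p * n + beta) + 11 * p = p * (24 * n + 11) + 24 * beta by ring.
    rewrite dvdn_addr ?(dvdn_mulr _ (dvdnn p)) //.
    rewrite (Euclid_dvdM _ _ p_prime) negb_or (gtnNdvd beta0 beta_p) andbT.
    have : ~~ (p %| 2 ^ 3 * 3); last by [].
    by rewrite Euclid_dvdM // Euclid_dvdX // !dvdn_prime2 // negb_or; lia.
  have om : odd (24 * (p * n + beta) + 11 * p) by rewrite oddD !oddM op.
  have [q qE] := prime_pow_mod24 (2 * k + 2) p_prime p_ge5.
  have pE : p ^ (4 * k + 4) = p ^ (4 * k + 3) * p.
    by rewrite -expnSr; congr (p ^ _); lia.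
  have {}qE : p ^ (4 * k + 4) = 24 * q + 1 by rewrite -qE; congr (p ^ _); lia.
  have -> : (11 * p ^ (4 * k + 4) - 5) %/ 6 = 4 * (11 * q) + 1 by rewrite qE; lia.
  have -> : 4 * p ^ (4 * k + 4) * n + 4 * p ^ (4 * k + 3) * beta + (4 * (11 * q) + 1)
    = 4 * (p ^ (4 * k + 4) * n + p ^ (4 * k + 3) * beta + 11 * q) + 1 by ring.
  rewrite modn2 odd_b21 -/(rep_parity _).
  have -> : 24 * (p ^ (4 * k + 4) * n + p ^ (4 * k + 3) * beta + 11 * q) + 11
    = p ^ (4 * k + 3) * (24 * (p * n + beta) + 11 * p).
    have -> : 24 * (p ^ (4 * k + 4) * n + p ^ (4 * k + 3) * beta + 11 * q) + 11
      = 24 * (p ^ (4 * k + 4) * n + p ^ (4 * k + 3) * beta) + 11 * (24 * q + 1) by ring.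
    by rewrite -qE pE; ring.
  suff -> : rep_parity (p ^ (4 * k + 3) * (24 * (p * n + beta) + 11 * p)) = false by [].
  (* Without [lam] the parity at p^3 m is 0, and four more factors p do not change it. *)
  elim: k {pE qE} => [|k IHk]; first by rewrite rec3.
  by rewrite (_ : 4 * k.+1 + 3 = 4 * k + 3 + 4) ?rec4 //; lia.
move=> k; rewrite -!modn2 (_ : 4 * k = 2 * (2 * k)); last by lia.
rewrite b21E0; suff -> : rep_parity (p ^ (2 * (2 * k)) * 11) by [].
elim: k => [|k IHk]; first by rewrite mul1n.
by rewrite (_ : 2 * (2 * k.+1) = 2 * (2 * k) + 4) ?rec4 //; lia.
Qed.
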